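(* Let $(\mathcal A,\sigma)$ be a non-degenerate braided quiver over a non-empty set $\mathcal P$, let $\mathbb G_{\mathcal A}$ be its structure groupoid, and let $\iota:\mathcal A\to\mathbb G_{\mathcal A}$ be the canonical map. Then: (a) There is a unique structure of braided groupoid on the groupoid $\mathbb G_{\mathcal A}$ such that $\iota$ is a morphism of braided quivers. (b) The braided groupoid $\mathbb G_{\mathcal A}$, with the structure in (a), is universal in the following sense: if $\mathcal G$ is a braided groupoid over $\mathcal P$ and $\varphi:\mathcal A\to\mathcal G$ is a morphism of braided quivers, then there is a unique morphism of braided groupoids $\widehat\varphi:\mathbb G_{\mathcal A}\to\mathcal G$ such that $\varphi=\widehat\varphi\,\iota$.
   Context: A quiver over $\mathcal P$ is a set $\mathcal A$ with maps $\mathfrak s,\mathfrak e:\mathcal A\to\mathcal P$; morphisms over $\mathcal P$ preserve $\mathfrak s,\mathfrak e$; $\mathcal A\,{}_{\mathfrak e}\times_{\mathfrak s}\mathcal B=\{(a,b):\mathfrak e(a)=\mathfrak s(b)\}$ with source $\mathfrak s(a)$, end $\mathfrak e(b)$. A braided quiver is $(\mathcal A,\sigma)$ with $\sigma$ an automorphism of the quiver $\mathcal A\,{}_{\mathfrak e}\times_{\mathfrak s}\mathcal A$ satisfying the braid equation $(\sigma\times\mathrm{id})(\mathrm{id}\times\sigma)(\sigma\times\mathrm{id})=(\mathrm{id}\times\sigma)(\sigma\times\mathrm{id})(\mathrm{id}\times\sigma)$. Write $\sigma(x,y)=(x\rightharpoonup y,x\leftharpoonup y)$. It is non-degenerate if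 for all $x$ the maps $x\rightharpoonup\_:\mathfrak s^{-1}(\mathfrak e(x))\to\mathfrak s^{-1}(\mathfrak s(x))$ and $\_\leftharpoonup x:\mathfrak e^{-1}(\mathfrak s(x))\to\mathfrak e^{-1}(\mathfrak e(x))$ are bijections. A morphism of braided quivers is a morphism $T$ of quivers over $\mathcal P$ such that $T\times T$ intertwines the braidings. The structure groupoid $\mathbb G_{\mathcal A}$ is the groupoid over $\mathcal P$ generated by $\mathcal A$ with relations $xy=(x\rightharpoonup y)(x\leftharpoonup y)$ for $(x,y)\in\mathcal A\,{}_{\mathfrak e}\times_{\mathfrak s}\mathcal A$ (quotient of the free groupoid on $\mathcal A$ by the smallest wide normal subgroup bundle containing the elements $xy(x\leftharpoonup y)^{-1}(x\rightharpoonup y)^{-1}$). Products $fg$ in a groupoid are defined when $\mathfrak e(f)=\mathfrak s(g)$; groupoid morphisms are the identity on $\mathcal P$. A braided groupoid is a groupoid $\mathcal G$ over $\mathcal P$ with a left action $\rightharpoonup$ of $\mathcal G$ on $\mathfrak s:\mathcal G\to\mathcal P$ (defined on composable pairs, $\mathfrak s(g\rightharpoonup x)=\mathfrak s(g)$, $g\rightharpoonup(h\rightharpoonup x)=gh\rightharpoonup x$, $\mathrm{id}\rightharpoonup x=x$) and a right action $\leftharpoonup$ of $\mathcal G$ on $\mathfrak e:\mathcal G\to\mathcal P$ (defined on composable pairs, $\mathfrak e(x\leftharpoonup g)=\mathfrak e(g)$, $(x\leftharpoonup g)\leftharpoonup h=x\leftharpoonup gh$, $x\leftharpoonup\mathrm{id}=x$)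 such that $\mathfrak e(x\rightharpoonup g)=\mathfrak s(x\leftharpoonup g)$, $x\rightharpoonup fg=(x\rightharpoonup f)((x\leftharpoonup f)\rightharpoonup g)$, $xy\leftharpoonup g=(x\leftharpoonup(y\rightharpoonup g))(y\leftharpoonup g)$, and $fg=(f\rightharpoonup g)(f\leftharpoonup g)$. A braided groupoid is a (non-degenerate) braided quiver via $(f,g)\mapsto(f\rightharpoonup g,f\leftharpoonup g)$. A morphism of braided groupoids is a morphism of groupoids preserving both actions. *)

(* Defs.v *)
From Stdlib Require Import Relation_Operators.
From mathcomp Require Import all_boot boolp.

Set Implicit Arguments.
Unset Strict Implicit.
Unset Printing Implicit Defensive.

Local Open Scope quotient_scope.

Record quiver (P : Type) := Quiver {
  arrow :> Type;
  src : arrow -> P;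
  tgt : arrow -> P }.

Record qhom (P : Type) (A B : quiver P) := QHom {
  qmap :> A -> B;
  qmap_src : forall x, src (qmap x) = src x;
  qmap_tgt : forall x, tgt (qmap x) = tgt x }.

Lemma qhom_composable (P : Type) (A A' B B' : quiver P) (f : qhom A A')
    (g : qhom B B') x y : tgt x = src y -> tgt (f x) = src (g y).
Proof. by rewrite qmap_tgt qmap_src. Qed.

Definition qid (P : Type) (A : quiver P) : qhom A A :=
  QHom (fun=> erefl) (fun=> erefl).

Definition qcomp (P : Type) (A B C : quiver P) (g : qhom B C) (f : qhom A B) :
    qhom A C :=
  QHom (fun x => etrans (qmap_src g (f x)) (qmap_src f x))
       (fun x => etrans (qmap_tgt g (f x)) (qmap_tgt f x)).

Definition qprod (P : Type) (A B : quiver P) : quiver P :=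
  @Quiver P {ab : A * B | tgt ab.1 = src ab.2}
    (fun u => src (sval u).1) (fun u => tgt (sval u).2).

Definition qpair (P : Type) (A B : quiver P) (a : A) (b : B)
  (ab : tgt a = src b) : qprod A B := exist _ (a, b) ab.

Definition qprod_map (P : Type) (A A' B B' : quiver P) (f : qhom A A')
    (g : qhom B B') : qhom (qprod A B) (qprod A' B') :=
  @QHom P (qprod A B) (qprod A' B')
    (fun u => qpair (qhom_composable f g (proj2_sig u)))
    (fun u => qmap_src f (sval u).1) (fun u => qmap_tgt g (sval u).2).

Definition qassoc (P : Type) (A B C : quiver P) :
    qhom (qprod (qprod A B) C) (qprod A (qprod B C)) :=
  @QHom P (qprod (qprod A B) C) (qprod A (qprod B C))
    (fun t => @qpair P A (qprod B C) (sval (sval t).1).1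
                (@qpair P B C (sval (sval t).1).2 (sval t).2 (proj2_sig t))
                (proj2_sig (sval t).1))
    (fun=> erefl) (fun=> erefl).

Definition qassocV (P : Type) (A B C : quiver P) :
    qhom (qprod A (qprod B C)) (qprod (qprod A B) C) :=
  @QHom P (qprod A (qprod B C)) (qprod (qprod A B) C)
    (fun t => @qpair P (qprod A B) C
                (@qpair P A B (sval t).1 (sval (sval t).2).1 (proj2_sig t))
                (sval (sval t).2).2 (proj2_sig (sval t).2))
    (fun=> erefl) (fun=> erefl).

Definition braid_eq (P : Type) (A : quiver P)
    (s : qhom (qprod A A) (qprod A A)) : Prop :=
  let s1 := qprod_map s (qid A) in
  let s2 := qcomp (qassocV A A A) (qcomp (qprod_map (qid A) s) (qassoc A A A)) in
  forall t : qprod (qprod A A) A, s1 (s2 (s1 t)) = s2 (s1 (s2 t)).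

Record braided_quiver (P : Type) := BraidedQuiver {
  bquiver :> quiver P;
  braid : qhom (qprod bquiver bquiver) (qprod bquiver bquiver);
  braid_bij : bijective braid;
  braidP : braid_eq braid }.

(** [braid A (x, y) = (lft x y, rgt x y)], usually written
    [(x -> y, x <- y)] with harpoons. *)
Definition lft (P : Type) (A : braided_quiver P) (x y : A)
  (xy : tgt x = src y) : A := (sval (braid A (qpair xy))).1.

Definition rgt (P : Type) (A : braided_quiver P) (x y : A)
  (xy : tgt x = src y) : A := (sval (braid A (qpair xy))).2.

Lemma src_lft (P : Type) (A : braided_quiver P) (x y : A)
  (xy : tgt x = src y) : src (lft xy) = src x.
Proof. exact: (qmap_src (braid A) (qpair xy)). Qed.

Lemma tgt_rgt (P : Type) (A : braided_quiver P) (x y : A)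
  (xy : tgt x = src y) : tgt (rgt xy) = tgt y.
Proof. exact: (qmap_tgt (braid A) (qpair xy)). Qed.

Lemma tgt_lft (P : Type) (A : braided_quiver P) (x y : A)
  (xy : tgt x = src y) : tgt (lft xy) = src (rgt xy).
Proof. exact: (proj2_sig (braid A (qpair xy))). Qed.

Definition src_fiber (P : Type) (A : quiver P) (p : P) : Type :=
  {x : A | src x = p}.

Definition tgt_fiber (P : Type) (A : quiver P) (p : P) : Type :=
  {x : A | tgt x = p}.

Definition lft_map (P : Type) (A : braided_quiver P) (x : A)
    (y : src_fiber A (tgt x)) : src_fiber A (src x) :=
  exist _ (lft (esym (proj2_sig y))) (src_lft (esym (proj2_sig y))).

Definition rgt_map (P : Type) (A : braided_quiver P) (x : A)
    (y : tgt_fiber A (src x)) : tgt_fiber A (tgt x) :=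
  exist _ (rgt (proj2_sig y)) (tgt_rgt (proj2_sig y)).

Definition nondegenerate (P : Type) (A : braided_quiver P) : Prop :=
  forall x : A, bijective (@lft_map P A x) /\ bijective (@rgt_map P A x).

Definition is_braided_morphism (P : Type) (A B : braided_quiver P)
    (T : qhom A B) : Prop :=
  forall u : qprod A A, qprod_map T T (braid A u) = braid B (qprod_map T T u).

(** The product is defined on composable pairs only.  Here and below, laws
    quantify over all proofs of composability of the pairs involved; these
    proofs always exist, by the laws on [src] and [tgt]. *)
Record groupoid (P : Type) := Groupoid {
  gquiver :> quiver P;
  mul : forall f g : gquiver, tgt f = src g -> gquiver;
  one : P -> gquiver;
  inv : gquiver -> gquiver;
  src_mul : forall f g fg, src (@mul f g fg) = src f;
  tgt_mul : forall f g fg, tgt (@mul f g fg) = tgt g;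
  src_one : forall p, src (one p) = p;
  tgt_one : forall p, tgt (one p) = p;
  src_inv : forall f, src (inv f) = tgt f;
  tgt_inv : forall f, tgt (inv f) = src f;
  mulA : forall f g k (fg : tgt f = src g) (gk : tgt g = src k)
    (fg_k : tgt (mul fg) = src k) (f_gk : tgt f = src (mul gk)),
    mul f_gk = mul fg_k;
  mul1g : forall f (c : tgt (one (src f)) = src f), mul c = f;
  mulg1 : forall f (c : tgt f = src (one (tgt f))), mul c = f;
  mulgV : forall f (c : tgt f = src (inv f)), mul c = one (src f);
  mulVg : forall f (c : tgt (inv f) = src f), mul c = one (tgt f) }.

Arguments mul {P g} f g0 _ : rename.
Arguments one {P} g _ : rename.
Arguments inv {P g} _ : rename.

Record ghom (P : Type) (G H : groupoid P) := GHom {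
  gmap :> qhom G H;
  gmap_one : forall p, gmap (one G p) = one H p;
  gmap_mul : forall f g (fg : tgt f = src g) (fg' : tgt (gmap f) = src (gmap g)),
    gmap (mul f g fg) = mul (gmap f) (gmap g) fg' }.

Definition is_left_action (P : Type) (G : groupoid P) (X : Type) (p : X -> P)
    (act : forall (g : G) (x : X), tgt g = p x -> X) : Prop :=
  [/\ forall g x gx, p (act g x gx) = src g,
      forall g h x (hx : tgt h = p x) (g_hx : tgt g = p (act h x hx))
        (gh : tgt g = src h) (gh_x : tgt (mul g h gh) = p x),
        act g (act h x hx) g_hx = act (mul g h gh) x gh_x
    & forall x c, act (one G (p x)) x c = x].

Definition is_right_action (P : Type) (G : groupoid P) (X : Type) (p : X -> P)
    (act : forall (x : X) (g : G), p x = src g -> X) : Prop :=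
  [/\ forall x g xg, p (act x g xg) = tgt g,
      forall x g h (xg : p x = src g) (xg_h : p (act x g xg) = src h)
        (gh : tgt g = src h) (x_gh : p x = src (mul g h gh)),
        act (act x g xg) h xg_h = act x (mul g h gh) x_gh
    & forall x c, act x (one G (p x)) c = x].

Record braided_structure (P : Type) (G : groupoid P) := BraidedStructure {
  lact : forall f g : G, tgt f = src g -> G;
  ract : forall f g : G, tgt f = src g -> G;
  lactP : is_left_action lact;
  ractP : is_right_action ract;
  tgt_lact : forall f g fg, tgt (@lact f g fg) = src (@ract f g fg);
  lact_mul : forall x f g (xf : tgt x = src f) (fg : tgt f = src g)
    (x_fg : tgt x = src (mul f g fg)) (xf_g : tgt (ract xf) = src g)
    (c : tgt (lact xf) = src (lact xf_g)),
    lact x_fg = mul (lact xf) (lact xf_g) c;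
  ract_mul : forall x y g (xy : tgt x = src y) (yg : tgt y = src g)
    (xy_g : tgt (mul x y xy) = src g) (x_yg : tgt x = src (lact yg))
    (c : tgt (ract x_yg) = src (ract yg)),
    ract xy_g = mul (ract x_yg) (ract yg) c;
  lact_ract : forall f g (fg : tgt f = src g)
    (c : tgt (lact fg) = src (ract fg)),
    mul f g fg = mul (lact fg) (ract fg) c }.

Arguments lact {P G} b f g _ : rename.
Arguments ract {P G} b f g _ : rename.

Record bghom (P : Type) (G H : groupoid P) (B : braided_structure G)
    (C : braided_structure H) := BGHom {
  bgmap :> ghom G H;
  bgmap_lact : forall f g (fg : tgt f = src g)
    (fg' : tgt (bgmap f) = src (bgmap g)),
    bgmap (lact B f g fg) = lact C (bgmap f) (bgmap g) fg';
  bgmap_ract : forall f g (fg : tgt f = src g)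
    (fg' : tgt (bgmap f) = src (bgmap g)),
    bgmap (ract B f g fg) = ract C (bgmap f) (bgmap g) fg' }.

Section GroupoidTheory.
Context (P : Type) (G : groupoid P).
Implicit Types f g k : G.

Definition endE := (@src_mul P G, @tgt_mul P G, @src_one P G, @tgt_one P G,
  @src_inv P G, @tgt_inv P G).

Lemma mul_congr f f' g g' c c' :
  f = f' -> g = g' -> mul f g c = mul f' g' c'.
Proof.
move=> ef eg; move: c c'; rewrite ef eg => c c'.
by congr mul; apply: Prop_irrelevance.
Qed.

Lemma mul1K e f c : e = one G (src f) -> mul e f c = f.
Proof. by move=> ee; move: c; rewrite ee => c; rewrite mul1g. Qed.

Lemma mulK1 e f c : e = one G (tgt f) -> mul f e c = f.
Proof. by move=> ee; move: c; rewrite ee => c; rewrite mulg1. Qed.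

Lemma mulKg f g (c : tgt f = src g) (d : tgt (inv f) = src (mul f g c)) :
  mul (inv f) (mul f g c) d = g.
Proof.
have e : tgt (inv f) = src f by rewrite endE.
have e1 : tgt (mul (inv f) f e) = src g by rewrite endE.
by rewrite (mulA e1 d) mul1K // mulVg c.
Qed.

Lemma mulKVg f g (c : tgt (inv f) = src g) (d : tgt f = src (mul (inv f) g c)) :
  mul f (mul (inv f) g c) d = g.
Proof.
have e : tgt f = src (inv f) by rewrite endE.
have e1 : tgt (mul f (inv f) e) = src g by rewrite endE.
by rewrite (mulA e1 d) mul1K // mulgV -c endE.
Qed.

Lemma mulgKV f g (c : tgt f = src (inv g)) (d : tgt (mul f (inv g) c) = src g) :
  mul (mul f (inv g) c) g d = f.
Proof.
have e : tgt (inv g) = src g by rewrite endE.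
have e1 : tgt f = src (mul (inv g) g e) by rewrite endE c.
by rewrite -(mulA d e1) mulK1 // mulVg c endE.
Qed.

Lemma mulgK f g (c : tgt f = src g) (d : tgt (mul f g c) = src (inv g)) :
  mul (mul f g c) (inv g) d = f.
Proof.
have e : tgt g = src (inv g) by rewrite endE.
have e1 : tgt f = src (mul g (inv g) e) by rewrite endE c.
by rewrite -(mulA d e1) mulK1 // mulgV c.
Qed.

Lemma inv_uniq f g (c : tgt f = src g) : mul f g c = one G (src f) -> f = inv g.
Proof.
move=> e.
have d : tgt (mul f g c) = src (inv g) by rewrite !endE.
rewrite -(mulgK d); apply: mul1K.
by rewrite e endE -(tgt_mul c) e endE.
Qed.

Lemma invK f : inv (inv f) = f.
Proof.
have c : tgt f = src (inv f) by rewrite endE.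
by apply/esym/(inv_uniq (c:=c)); rewrite mulgV.
Qed.

Lemma invM f g c c' : inv (mul f g c) = mul (inv g) (inv f) c'.
Proof.
have d : tgt (mul (inv g) (inv f) c') = src (mul f g c) by rewrite !endE.
apply/esym/(inv_uniq (c:=d)); rewrite !endE.
have e : tgt (inv f) = src (mul f g c) by rewrite !endE.
have e' : tgt (inv g) = src (mul (inv f) (mul f g c) e) by rewrite !endE.
rewrite -(mulA d e').
have e2 : tgt (inv g) = src g by rewrite endE.
by rewrite (mul_congr e' e2 erefl (mulKg e)) mulVg.
Qed.

Lemma inv_one p : inv (one G p) = one G p.
Proof.
have c : tgt (one G p) = src (one G p) by rewrite !endE.
apply/esym/(inv_uniq (c:=c)); rewrite mulK1 ?endE //.
Qed.

End GroupoidTheory.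

Lemma qprod_eq (P : Type) (A B : quiver P) (u v : qprod A B) :
  (sval u).1 = (sval v).1 -> (sval u).2 = (sval v).2 -> u = v.
Proof.
case: u v => [[a b] ab] [[a' b'] ab'] /= ea eb.
move: ab ab'; rewrite {}ea {}eb => ab ab'.
by congr exist; apply: Prop_irrelevance.
Qed.

Lemma sval_inj (T : Type) (Q : T -> Prop) (u v : {x | Q x}) :
  sval u = sval v -> u = v.
Proof.
case: u v => [a p] [b q] /= e; move: p q; rewrite e => p q.
by congr exist; apply: Prop_irrelevance.
Qed.

Section BraidedGroupoidTheory.
Context (P : Type) (G : groupoid P) (B : braided_structure G).
Implicit Types f g k : G.

Lemma src_lact f g c : src (lact B f g c) = src f.
Proof. by case: (lactP B). Qed.

Lemma tgt_ract f g c : tgt (ract B f g c) = tgt g.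
Proof. by case: (ractP B). Qed.

Lemma lact_congr f f' g g' c c' :
  f = f' -> g = g' -> lact B f g c = lact B f' g' c'.
Proof.
move=> ef eg; move: c c'; rewrite ef eg => c c'.
by congr lact; apply: Prop_irrelevance.
Qed.

Lemma ract_congr f f' g g' c c' :
  f = f' -> g = g' -> ract B f g c = ract B f' g' c'.
Proof.
move=> ef eg; move: c c'; rewrite ef eg => c c'.
by congr ract; apply: Prop_irrelevance.
Qed.

Lemma lact1 e f c : e = one G (src f) -> lact B e f c = f.
Proof. by move=> ee; move: c; rewrite ee => c; case: (lactP B) => _ _ ->. Qed.

Lemma ract1 e f c : e = one G (tgt f) -> ract B f e c = f.
Proof. by move=> ee; move: c; rewrite ee => c; case: (ractP B) => _ _ ->. Qed.

Lemma lact_lact f g k (gk : tgt g = src k) (f_gk : tgt f = src (lact B g k gk))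
    (fg : tgt f = src g) (fg_k : tgt (mul f g fg) = src k) :
  lact B f (lact B g k gk) f_gk = lact B (mul f g fg) k fg_k.
Proof. by case: (lactP B) => _ h _; apply: h. Qed.

Lemma ract_ract f g k (fg : tgt f = src g) (fg_k : tgt (ract B f g fg) = src k)
    (gk : tgt g = src k) (f_gk : tgt f = src (mul g k gk)) :
  ract B (ract B f g fg) k fg_k = ract B f (mul g k gk) f_gk.
Proof. by case: (ractP B) => _ h _; apply: h. Qed.

Lemma lactK f g (fg : tgt f = src g) c : lact B (inv f) (lact B f g fg) c = g.
Proof.
have d : tgt (inv f) = src f by rewrite endE.
have d' : tgt (mul (inv f) f d) = src g by rewrite endE.
by rewrite (lact_lact (fg:=d) c d') lact1 // mulVg fg.
Qed.

Lemma lactKV f g (fg : tgt (inv f) = src g) c :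
  lact B f (lact B (inv f) g fg) c = g.
Proof.
have d : tgt f = src (inv f) by rewrite endE.
have d' : tgt (mul f (inv f) d) = src g by rewrite endE.
by rewrite (lact_lact (fg:=d) c d') lact1 // mulgV -fg endE.
Qed.

Lemma ractK f g (fg : tgt f = src g) c : ract B (ract B f g fg) (inv g) c = f.
Proof.
have d : tgt g = src (inv g) by rewrite endE.
have d' : tgt f = src (mul g (inv g) d) by rewrite endE.
by rewrite (ract_ract (gk:=d) c d') ract1 // mulgV fg.
Qed.

Lemma ractKV f g (fg : tgt f = src (inv g)) c :
  ract B (ract B f (inv g) fg) g c = f.
Proof.
have d : tgt (inv g) = src g by rewrite endE.
have d' : tgt f = src (mul (inv g) g d) by rewrite fg !endE.
by rewrite (ract_ract (gk:=d) c d') ract1 // mulVg fg endE.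
Qed.

Definition bs_braid : qhom (qprod G G) (qprod G G) :=
  @QHom P (qprod G G) (qprod G G)
    (fun u => qpair (tgt_lact B (proj2_sig u)))
    (fun u => src_lact (proj2_sig u)) (fun u => tgt_ract (proj2_sig u)).

Lemma ract_inv f g (fg : tgt f = src g) (c : tgt (inv f) = src (lact B f g fg)) :
  ract B (inv f) (lact B f g fg) c = inv (ract B f g fg).
Proof.
set u := lact B f g fg in c *; set v := ract B f g fg; set w := ract _ _ _ _.
have uv : tgt u = src v by rewrite tgt_lact.
have e1 : mul f g fg = mul u v uv by rewrite (lact_ract uv).
have d2 : tgt (lact B (inv f) u c) = src w by rewrite tgt_lact.
have gw : tgt g = src w by rewrite -d2 lactK.
have e2 : mul (inv f) u c = mul g w gw.
  by rewrite (lact_ract d2); apply: mul_congr => //; apply: lactK.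
have wv : tgt w = src v by rewrite tgt_ract.
apply: (inv_uniq (c:=wv)).
have d3 : tgt (inv f) = src (mul u v uv) by rewrite !endE src_lact.
have d4 : tgt (mul (inv f) u c) = src v by rewrite endE.
have d5 : tgt g = src (mul w v wv) by rewrite endE.
have d6 : tgt (mul g w gw) = src v by rewrite endE.
have e3 : mul g (mul w v wv) d5 = g.
  rewrite (mulA d6 d5) -(mul_congr d4 d6 e2 erefl).
  rewrite -(mulA d4 d3).
  have d7 : tgt (inv f) = src (mul f g fg) by rewrite !endE.
  by rewrite -(mul_congr d7 d3 erefl e1) mulKg.
have d8 : tgt (inv g) = src (mul g (mul w v wv) d5) by rewrite !endE.
have d9 : tgt (inv g) = src g by rewrite !endE.
by rewrite -(mulKg d8) (mul_congr d8 d9 erefl e3) mulVg gw.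
Qed.

Lemma bs_braid_bij : bijective bs_braid.
Proof.
pose fi (u : qprod G G) := ract B (inv (sval u).2) (inv (sval u).1)
  (etrans (tgt_inv _) (etrans (esym (proj2_sig u)) (esym (src_inv _)))).
have fiu u : tgt (fi u) = src (sval u).1 by rewrite tgt_ract endE.
have gu u : tgt (inv (fi u)) = src (lact B (fi u) (sval u).1 (fiu u)).
  by rewrite endE src_lact.
exists (fun u => qpair (gu u)) => u.
  case: u => [[f g] /= fg].
  have efi : fi (bs_braid (qpair fg)) = inv f.
    have c : tgt (inv f) = src (lact B f g fg) by rewrite endE src_lact.
    have d : tgt (ract B (inv f) _ c) = src (inv (lact B f g fg)).
      by rewrite tgt_ract endE.
    by rewrite -[RHS](ractK d); apply: ract_congr => /=; rewrite ?ract_inv.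
  apply: qprod_eq => /=; first by rewrite efi invK.
  have c : tgt (inv f) = src (lact B f g fg) by rewrite endE src_lact.
  by rewrite -[RHS](lactK c); apply: lact_congr.
have e1 (c : tgt (inv (fi u)) = src (lact B (fi u) (sval u).1 (fiu u))) :
    lact B (inv (fi u)) (lact B (fi u) (sval u).1 (fiu u)) c = (sval u).1.
  exact: lactK.
apply: qprod_eq => /=; first exact: e1.
have d : tgt (inv (inv (fi u))) = src (sval u).1 by rewrite !endE.
have c : tgt (inv (inv (fi u))) = src (lact B (inv (fi u)) _ (gu u)).
  by rewrite e1.
rewrite -[LHS]invK -(ract_inv c).
rewrite (ract_congr c (fiu u) (invK _) (e1 _)).
by rewrite -[RHS]invK; congr inv; rewrite ractKV.
Qed.

Lemma mul_injr f f' g g' c c' :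
  mul f g c = mul f' g' c' -> g = g' -> f = f'.
Proof.
move=> e eg.
have d : tgt (mul f g c) = src (inv g) by rewrite !endE.
have d' : tgt (mul f' g' c') = src (inv g') by rewrite !endE.
rewrite -(mulgK d) -(mulgK d'); apply: mul_congr => //.
by rewrite eg.
Qed.

Lemma bs_braidP : braid_eq bs_braid.
Proof.
move=> t; case: t => [[[[f g] /= fg] k] /= gk].
have comp_lact x y z (xy : tgt x = src y) (yz : tgt (ract B x y xy) = src z)
    (c : tgt (lact B x y xy) = src (lact B _ z yz)) (d : tgt y = src z)
    (e : tgt x = src (lact B y z d)) :
    lact B (lact B x y xy) (lact B (ract B x y xy) z yz) c =
    lact B x (lact B y z d) e.
  have h : tgt (lact B x y xy) = src (ract B x y xy) by rewrite tgt_lact.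
  have h1 : tgt (mul (lact B x y xy) (ract B x y xy) h) = src z by rewrite endE.
  have h2 : tgt (mul x y xy) = src z by rewrite endE.
  rewrite (lact_lact c h1) (lact_lact e h2); apply: lact_congr => //.
  by rewrite -lact_ract.
have comp_ract x y z (xy : tgt x = src y) (yz : tgt (ract B x y xy) = src z)
    (d : tgt y = src z) (e : tgt x = src (lact B y z d))
    (c : tgt (ract B x _ e) = src (ract B y z d)) :
    ract B (ract B x y xy) z yz =
    ract B (ract B x (lact B y z d) e) (ract B y z d) c.
  have h : tgt (lact B y z d) = src (ract B y z d) by rewrite tgt_lact.
  have h1 : tgt x = src (mul (lact B y z d) (ract B y z d) h) by rewrite endE.
  have h2 : tgt x = src (mul y z d) by rewrite endE.
  rewrite (ract_ract yz h2) (ract_ract c h1); apply: ract_congr => //.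
  by rewrite -lact_ract.
apply: (@qprod_eq P (qprod G G) G) => /=; last exact: comp_ract.
apply: (@qprod_eq P G G) => /=; first exact: comp_lact.
match goal with |- ract _ _ _ ?p = lact _ _ _ ?q => move: (p) (q) end.
set b := ract B f g _; set a := lact B f g _.
set bk := lact B b k _; set u := lact B g k _; set v := ract B g k _.
set w := ract B f u _ => abk wv.
have ab : tgt a = src b by rewrite tgt_lact.
have ab_k : tgt (mul a b ab) = src k by rewrite !endE tgt_ract.
pose b_k : tgt b = src k := @qhom_composable P (qprod G G) _ G _ bs_braid
  (qid G) (qpair fg) k gk.
have c1 : tgt (ract B a bk abk) = src (ract B b k b_k).
  by rewrite tgt_ract tgt_lact; congr src; apply: ract_congr.
have e1 := ract_mul ab_k c1.
have fg_k : tgt (mul f g fg) = src k by rewrite !endE.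
pose c2 : tgt w = src v := wv.
have e2 := ract_mul fg_k c2.
have c3 : tgt (lact B w v wv) = src (ract B w v wv) by rewrite tgt_lact.
rewrite (lact_ract (fg:=c2) c3) in e2.
apply: (mul_injr (c:=c1) (c':=c3)).
  rewrite -e1 -e2; apply: ract_congr => //.
  exact/esym/lact_ract.
exact: comp_ract.
Qed.

Definition bs_braided_quiver : braided_quiver P :=
  BraidedQuiver bs_braid_bij bs_braidP.

Lemma bs_nondegenerate : nondegenerate bs_braided_quiver.
Proof.
move=> x; split.
  have h (y : src_fiber G (src x)) : tgt (inv x) = src (sval y).
    by rewrite endE (proj2_sig y).
  have h' (y : src_fiber G (src x)) : src (lact B (inv x) (sval y) (h y)) = tgt x.
    by rewrite src_lact endE.
  exists (fun y => (exist _ _ (h' y) : src_fiber G (tgt x))) => y; apply: sval_inj; rewrite /= /lft /=.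
    exact: lactK.
  exact: lactKV.
have h (y : tgt_fiber G (tgt x)) : tgt (sval y) = src (inv x).
  by rewrite endE (proj2_sig y).
have h' (y : tgt_fiber G (tgt x)) : tgt (ract B (sval y) (inv x) (h y)) = src x.
  by rewrite tgt_ract endE.
exists (fun y => (exist _ _ (h' y) : tgt_fiber G (src x))) => y; apply: sval_inj; rewrite /= /rgt /=.
  exact: ractK.
exact: ractKV.
Qed.

End BraidedGroupoidTheory.

Section PropQuotient.
Context (T : Type) (R : T -> T -> Prop).
Context (Rrefl : forall x, R x x) (Rsym : forall x y, R x y -> R y x)
  (Rtrans : forall x y z, R x y -> R y z -> R x z).

Let r : rel {classic T} := fun x y => `[< R x y >].

Lemma asbool_refl : reflexive r.
Proof. by move=> x; apply/asboolP. Qed.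

Lemma asbool_sym : symmetric r.
Proof. by move=> x y; apply/asboolP/asboolP; apply: Rsym. Qed.

Lemma asbool_trans : transitive r.
Proof.
by move=> y x z /asboolP xy /asboolP yz; apply/asboolP; apply: Rtrans yz.
Qed.

Definition equiv_of_Prop : equiv_rel {classic T} :=
  EquivRel r asbool_refl asbool_sym asbool_trans.

Definition Pquot : Type := {eq_quot equiv_of_Prop}.
Definition Pclass (x : T) : Pquot := \pi_({eq_quot equiv_of_Prop}) x.
Definition Prepr (q : Pquot) : T := repr (q : {eq_quot equiv_of_Prop}).

Lemma PreprK q : Pclass (Prepr q) = q.
Proof. exact: reprK. Qed.

Lemma PclassP x y : Pclass x = Pclass y <-> R x y.
Proof.
split=> [/eqquotP/asboolP //|xy]; apply/eqquotP; exact/asboolP.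
Qed.

Lemma Prepr_class x : R (Prepr (Pclass x)) x.
Proof. by apply/PclassP; rewrite PreprK. Qed.

End PropQuotient.

(** A groupoid whose laws hold only up to a congruence [eqv]; both the free
    groupoid and the quotient groupoids arise from such data by passing to
    classes. *)
Record pregroupoid (P : Type) := PreGroupoid {
  pquiver :> quiver P;
  eqv : pquiver -> pquiver -> Prop;
  pmul : forall f g : pquiver, tgt f = src g -> pquiver;
  pone : P -> pquiver;
  pinv : pquiver -> pquiver;
  eqv_refl : forall f, eqv f f;
  eqv_sym : forall f g, eqv f g -> eqv g f;
  eqv_trans : forall f g k, eqv f g -> eqv g k -> eqv f k;
  eqv_src : forall f g, eqv f g -> src f = src g;
  eqv_tgt : forall f g, eqv f g -> tgt f = tgt g;
  eqv_mul : forall f f' g g' fg fg',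
    eqv f f' -> eqv g g' -> eqv (@pmul f g fg) (@pmul f' g' fg');
  eqv_inv : forall f f', eqv f f' -> eqv (pinv f) (pinv f');
  src_pmul : forall f g fg, src (@pmul f g fg) = src f;
  tgt_pmul : forall f g fg, tgt (@pmul f g fg) = tgt g;
  src_pone : forall p, src (pone p) = p;
  tgt_pone : forall p, tgt (pone p) = p;
  src_pinv : forall f, src (pinv f) = tgt f;
  tgt_pinv : forall f, tgt (pinv f) = src f;
  pmulA : forall f g k (fg : tgt f = src g) (gk : tgt g = src k)
    (fg_k : tgt (pmul fg) = src k) (f_gk : tgt f = src (pmul gk)),
    eqv (pmul f_gk) (pmul fg_k);
  pmul1g : forall f (c : tgt (pone (src f)) = src f), eqv (pmul c) f;
  pmulg1 : forall f (c : tgt f = src (pone (tgt f))), eqv (pmul c) f;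
  pmulgV : forall f (c : tgt f = src (pinv f)), eqv (pmul c) (pone (src f));
  pmulVg : forall f (c : tgt (pinv f) = src f), eqv (pmul c) (pone (tgt f)) }.

Arguments pmul {P p} f g _ : rename.

Section ClassGroupoid.
Context (P : Type) (G : pregroupoid P).

Let T := Pquot (@eqv_refl P G) (@eqv_sym P G) (@eqv_trans P G).
Let cl : G -> T := @Pclass _ _ _ _ _.
Let rp : T -> G := @Prepr _ _ _ _ _.

Definition class_quiver : quiver P :=
  @Quiver P T (fun q => src (rp q)) (fun q => tgt (rp q)).

Let Q := class_quiver.
Let qmul (f g : Q) (fg : tgt f = src g) : Q := cl (pmul (rp f) (rp g) fg).
Let qone p : Q := cl (pone G p).
Let qinv (f : Q) : Q := cl (pinv (rp f)).

Let src_cl f : src (rp (cl f)) = src f.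
Proof. apply: (@eqv_src P G); apply: Prepr_class. Qed.
Let tgt_cl f : tgt (rp (cl f)) = tgt f.
Proof. apply: (@eqv_tgt P G); apply: Prepr_class. Qed.
Let rpK q : cl (rp q) = q. Proof. exact: PreprK. Qed.
Let clP f g : eqv f g -> cl f = cl g. Proof. by move/PclassP; apply. Qed.

Definition class_groupoid : groupoid P.
Proof.
refine (@Groupoid P Q qmul qone qinv _ _ _ _ _ _ _ _ _ _ _).
- by move=> f g fg; rewrite /= src_cl src_pmul.
- by move=> f g fg; rewrite /= tgt_cl tgt_pmul.
- by move=> p; rewrite /= src_cl src_pone.
- by move=> p; rewrite /= tgt_cl tgt_pone.
- by move=> f; rewrite /= src_cl src_pinv.
- by move=> f; rewrite /= tgt_cl tgt_pinv.
- move=> f g k fg gk fg_k f_gk; apply: clP.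
  have c1 : tgt (pmul (rp f) (rp g) fg) = src (rp k) by rewrite tgt_pmul.
  have c2 : tgt (rp f) = src (pmul (rp g) (rp k) gk) by rewrite src_pmul.
  apply: (@eqv_trans _ _ _ (pmul _ _ c2)).
    by apply: eqv_mul; [apply: eqv_refl | apply: Prepr_class].
  apply: eqv_trans (pmulA c1 c2) _.
  by apply/eqv_sym/eqv_mul; [apply: Prepr_class | apply: eqv_refl].
- move=> f c; rewrite -[RHS]rpK; apply: clP.
  have d : tgt (pone G (src (rp f))) = src (rp f) by rewrite tgt_pone.
  apply: eqv_trans (pmul1g d).
  by apply: eqv_mul; [apply: Prepr_class | apply: eqv_refl].
- move=> f c; rewrite -[RHS]rpK; apply: clP.
  have d : tgt (rp f) = src (pone G (tgt (rp f))) by rewrite src_pone.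
  apply: eqv_trans (pmulg1 d).
  by apply: eqv_mul; [apply: eqv_refl | apply: Prepr_class].
- move=> f c; apply: clP.
  have d : tgt (rp f) = src (pinv (rp f)) by rewrite src_pinv.
  apply: eqv_trans (pmulgV d).
  by apply: eqv_mul; [apply: eqv_refl | apply: Prepr_class].
- move=> f c; apply: clP.
  have d : tgt (pinv (rp f)) = src (rp f) by rewrite tgt_pinv.
  apply: eqv_trans (pmulVg d).
  by apply: eqv_mul; [apply: Prepr_class | apply: eqv_refl].
Defined.

Definition class_map : qhom G class_groupoid :=
  @QHom P G class_groupoid cl src_cl tgt_cl.

Lemma class_map_eq f g : class_map f = class_map g <-> eqv f g.
Proof. exact: PclassP. Qed.

Lemma class_map_surj (q : class_groupoid) : exists f, class_map f = q.
Proof. by exists (rp q); apply: rpK. Qed.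

Lemma class_map_one p : class_map (pone G p) = one class_groupoid p.
Proof. by []. Qed.

Lemma class_map_mul f g (fg : tgt f = src g) c :
  class_map (pmul f g fg) = mul (class_map f) (class_map g) c.
Proof.
apply: clP; apply: eqv_mul; apply: (@eqv_sym P G); exact: Prepr_class.
Qed.

Lemma class_map_inv f : class_map (pinv f) = inv (class_map f).
Proof.
apply: clP; apply: eqv_inv; apply: (@eqv_sym P G); exact: Prepr_class.
Qed.

End ClassGroupoid.

Record normal_bundle (P : Type) (G : groupoid P) (N : G -> Prop) : Prop := {
  nb_loop : forall f, N f -> src f = tgt f;
  nb_one : forall p, N (one G p);
  nb_mul : forall f g fg, N f -> N g -> N (mul f g fg);
  nb_inv : forall f, N f -> N (inv f);
  nb_conj : forall f n (fn : tgt f = src n) (c : tgt (mul f n fn) = src (inv f)),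
    N n -> N (mul (mul f n fn) (inv f) c) }.

Section Quotient.
Context (P : Type) (G : groupoid P) (N : G -> Prop) (NN : normal_bundle N).

Definition quotient_eqv (f g : G) : Prop :=
  exists c : tgt f = src (inv g), N (mul f (inv g) c).

Let eqv0 f g (c : tgt f = src (inv g)) : N (mul f (inv g) c) -> quotient_eqv f g.
Proof. by exists c. Qed.

Let Nmul f g c h : N h -> mul f g c = h -> N (mul f g c).
Proof. by move=> ? ->. Qed.

Lemma quotient_refl f : quotient_eqv f f.
Proof.
have c : tgt f = src (inv f) by rewrite endE.
by exists c; rewrite mulgV; apply: nb_one.
Qed.

Lemma quotient_src f g : quotient_eqv f g -> src f = src g.
Proof. by case=> c /(nb_loop NN); rewrite !endE. Qed.

Lemma quotient_tgt f g : quotient_eqv f g -> tgt f = tgt g.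
Proof. by case=> c _; rewrite c endE. Qed.

Lemma quotient_sym f g : quotient_eqv f g -> quotient_eqv g f.
Proof.
move=> fg; case: (fg) => c /(nb_inv NN).
have d : tgt g = src (inv f) by rewrite endE (quotient_tgt fg).
have d' : tgt (inv (inv g)) = src (inv f) by rewrite !endE (quotient_tgt fg).
by rewrite (invM c d') => n; exists d; apply: (Nmul n); apply: mul_congr;
  rewrite ?invK.
Qed.

Lemma quotient_trans f g k :
  quotient_eqv f g -> quotient_eqv g k -> quotient_eqv f k.
Proof.
case=> c n [d m]; have e : tgt f = src (inv k) by rewrite c endE.
exists e; have e1 : tgt (mul f (inv g) c) = src (mul g (inv k) d) by rewrite !endE.
apply: (Nmul (nb_mul NN e1 n m)).
have e2 : tgt (mul (mul f (inv g) c) g (etrans (tgt_mul _) (tgt_inv g))) =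
  src (inv k) by rewrite endE.
by rewrite (mulA e2 e1); apply: mul_congr => //; rewrite mulgKV.
Qed.

Lemma quotient_inv f g : quotient_eqv f g -> quotient_eqv (inv f) (inv g).
Proof.
move=> fg; case: (quotient_sym fg) => c n.
have c1 : tgt (inv f) = src (inv (inv g)) by rewrite !endE (quotient_src fg).
exists c1.
have c2 : tgt (inv f) = src (mul g (inv f) c) by rewrite !endE (quotient_src fg).
have c3 : tgt (mul (inv f) (mul g (inv f) c) c2) = src (inv (inv f)).
  by rewrite !endE.
apply: (Nmul (nb_conj NN c3 n)).
have c4 : tgt (inv f) = src g by rewrite !endE (quotient_src fg).
have c5 : tgt (mul (inv f) g c4) = src (inv f) by rewrite endE.
have c6 : tgt (mul (mul (inv f) g c4) (inv f) c5) = src (inv (inv f)).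
  by rewrite !endE.
by rewrite (mul_congr c3 c6 (mulA c5 c2) erefl) mulgK; apply: mul_congr;
  rewrite ?invK.
Qed.

Lemma quotient_mul f f' g g' fg fg' :
  quotient_eqv f f' -> quotient_eqv g g' ->
  quotient_eqv (mul f g fg) (mul f' g' fg').
Proof.
move=> ff' gg'; case: (ff') (gg') => c n [d m].
apply: (@quotient_trans _ (mul f g' (etrans fg (quotient_src gg')))).
  set e := etrans _ _.
  have e1 : tgt f = src (mul g (inv g') d) by rewrite endE.
  have e2 : tgt (mul f (mul g (inv g') d) e1) = src (inv f).
    by rewrite !endE e.
  have c1 : tgt (mul f g fg) = src (inv (mul f g' e)).
    by rewrite !endE (quotient_tgt gg').
  exists c1; apply: (Nmul (nb_conj NN e2 m)).
  have c2 : tgt (inv g') = src (inv f) by rewrite !endE.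
  have c3 : tgt (mul f g fg) = src (mul (inv g') (inv f) c2).
    by rewrite !endE (quotient_tgt gg').
  rewrite (mul_congr c1 c3 erefl (invM e c2)).
  have c4 : tgt (mul (mul f g fg) (inv g') (etrans c3 (src_mul _))) = src (inv f).
    by rewrite endE.
  have c5 : tgt (mul f g fg) = src (inv g') by rewrite !endE (quotient_tgt gg').
  rewrite (mulA c4 c3); apply: mul_congr => //.
  by rewrite (mulA (etrans (tgt_mul fg) d) e1); apply: mul_congr.
set e := etrans _ _.
have c1 : tgt (mul f g' e) = src (inv (mul f' g' fg')) by rewrite !endE.
exists c1; apply: (Nmul n).
have c2 : tgt (inv g') = src (inv f') by rewrite !endE.
have c3 : tgt (mul f g' e) = src (mul (inv g') (inv f') c2) by rewrite !endE.
rewrite (mul_congr c1 c3 erefl (invM fg' c2)).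
have c4 : tgt (mul f g' e) = src (inv g') by rewrite !endE.
have c5 : tgt (mul (mul f g' e) (inv g') c4) = src (inv f') by rewrite endE.
by rewrite (mulA c5 c3); apply: mul_congr => //; apply: mulgK.
Qed.

Definition quotient_pregroupoid : pregroupoid P.
Proof.
refine (@PreGroupoid P G quotient_eqv (@mul P G) (@one P G) (@inv P G)
  quotient_refl quotient_sym quotient_trans quotient_src quotient_tgt
  quotient_mul quotient_inv (@src_mul P G) (@tgt_mul P G) (@src_one P G)
  (@tgt_one P G) (@src_inv P G) (@tgt_inv P G) _ _ _ _ _) => *.
- by rewrite mulA; apply: quotient_refl.
- by rewrite mul1g; apply: quotient_refl.
- by rewrite mulg1; apply: quotient_refl.
- by rewrite mulgV; apply: quotient_refl.
- by rewrite mulVg; apply: quotient_refl.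
Defined.

Definition quotient_groupoid : groupoid P := class_groupoid quotient_pregroupoid.

Definition quotient_map : qhom G quotient_groupoid :=
  class_map quotient_pregroupoid.

End Quotient.

(** When [S] consists of loops this is the smallest wide normal subgroup bundle
    containing [S]; [normal_bundle] contains only loops. *)
Definition normal_closure (P : Type) (G : groupoid P) (S : G -> Prop) (f : G) :
    Prop :=
  forall N : G -> Prop, normal_bundle N -> (forall r, S r -> N r) -> N f.

Lemma normal_bundle_loops (P : Type) (G : groupoid P) :
  normal_bundle (fun f : G => src f = tgt f).
Proof. by split=> *; rewrite ?endE; congruence. Qed.

Lemma normal_closure_bundle (P : Type) (G : groupoid P) (S : G -> Prop) :
  (forall r, S r -> src r = tgt r) -> normal_bundle (normal_closure S).
Proof.
move=> Sl; split.
- by move=> f /(_ _ (normal_bundle_loops G)); apply.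
- by move=> p N NN _; apply: nb_one.
- by move=> f g fg hf hg N NN NS; apply: nb_mul; [|apply: hf|apply: hg].
- by move=> f hf N NN NS; apply: nb_inv => //; apply: hf.
- by move=> f n fn c hn N NN NS; apply: nb_conj => //; apply: hn.
Qed.

Section Free.
Context (P : Type) (A : quiver P).

(** The letter [(true, a)] stands for [a], and [(false, a)] for [a^-1]. *)
Definition letter : Type := bool * A.
Definition flip (l : letter) : letter := (~~ l.1, l.2).
Definition letter_src (l : letter) : P := if l.1 then src l.2 else tgt l.2.
Definition letter_tgt (l : letter) : P := if l.1 then tgt l.2 else src l.2.

Fixpoint is_path (p : P) (w : seq letter) (q : P) : Prop :=
  if w is l :: w' then letter_src l = p /\ is_path (letter_tgt l) w' q
  else p = q.

Record path := Path {
  path_src : P;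
  path_word : seq letter;
  path_tgt : P;
  pathP : is_path path_src path_word path_tgt }.

(** [v] is obtained from [u] by deletion of a subword [a a^-1] or [a^-1 a]. *)
Definition cancels (u v : path) : Prop :=
  [/\ path_src u = path_src v, path_tgt u = path_tgt v
    & exists w1 l w2, path_word u = w1 ++ l :: flip l :: w2 /\
                      path_word v = w1 ++ w2].

Definition path_eqv : path -> path -> Prop := clos_refl_sym_trans path cancels.

Definition word_inv (w : seq letter) : seq letter := rev (map flip w).

Lemma is_path_cat p q r w1 w2 :
  is_path p w1 q -> is_path q w2 r -> is_path p (w1 ++ w2) r.
Proof.
elim: w1 p => [|l w1 IH] p /= => [-> //|[<- h1] h2].
by split=> //; apply: IH.
Qed.

Lemma letter_src_flip l : letter_src (flip l) = letter_tgt l.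
Proof. by case: l => [[] a]. Qed.

Lemma letter_tgt_flip l : letter_tgt (flip l) = letter_src l.
Proof. by case: l => [[] a]. Qed.

Lemma flipK : involutive flip.
Proof. by case=> [[] a]. Qed.

Lemma is_path_inv p q w : is_path p w q -> is_path q (word_inv w) p.
Proof.
elim: w p => [|l w IH] p /= => [-> //|[<- /IH h]].
rewrite /word_inv /= rev_cons -cats1; apply: is_path_cat h _ => /=.
by rewrite letter_src_flip letter_tgt_flip.
Qed.

Definition path_quiver : quiver P := Quiver path_src path_tgt.

Definition path_mul (u v : path_quiver) (uv : tgt u = src v) : path_quiver :=
  Path (is_path_cat (pathP u) (eq_ind_r (fun q => is_path q _ _) (pathP v) uv)).

Definition path_one (p : P) : path_quiver := @Path p [::] p erefl.

Definition path_inv (u : path_quiver) : path_quiver :=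
  Path (is_path_inv (pathP u)).

Definition path_letter (l : letter) : path_quiver :=
  @Path (letter_src l) [:: l] (letter_tgt l) (conj erefl erefl).

Lemma path_eq (u v : path) : path_src u = path_src v ->
  path_word u = path_word v -> path_tgt u = path_tgt v -> u = v.
Proof.
case: u v => [p w q h] [p' w' q' h'] /= ep ew eq.
by move: h h'; rewrite ep ew eq => h h'; congr Path; apply: Prop_irrelevance.
Qed.

Lemma path_eqv_src (u v : path_quiver) : path_eqv u v -> src u = src v.
Proof. by elim=> [? ? []|//|//|? ? ? _ -> _ ->]. Qed.

Lemma path_eqv_tgt (u v : path_quiver) : path_eqv u v -> tgt u = tgt v.
Proof. by elim=> [? ? []|//|//|? ? ? _ -> _ ->]. Qed.

Lemma path_eqv_mull u u' v c c' :
  path_eqv u u' -> path_eqv (@path_mul u v c) (@path_mul u' v c').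
Proof.
move=> h; elim: h v c c' => {u u'}.
- move=> u u' [es et [w1 [l [w2 [e e']]]]] v c c'; apply: rst_step; split=> //=.
  by exists w1, l, (w2 ++ path_word v); rewrite e e' -!catA.
- by move=> u v c c'; rewrite (Prop_irrelevance c c'); apply: rst_refl.
- by move=> u u' _ IH v c c'; apply/rst_sym/IH.
- move=> u v w uv IH1 vw IH2 k c c'.
  have d : @tgt P path_quiver v = src k by rewrite -c (path_eqv_tgt uv).
  by apply: rst_trans (IH1 _ _ d) (IH2 _ _ _).
Qed.

Lemma path_eqv_mulr u v v' c c' :
  path_eqv v v' -> path_eqv (@path_mul u v c) (@path_mul u v' c').
Proof.
move=> h; elim: h u c c' => {v v'}.
- move=> v v' [es et [w1 [l [w2 [e e']]]]] u c c'; apply: rst_step; split=> //=.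
  by exists (path_word u ++ w1), l, w2; rewrite e e' -!catA.
- by move=> v u c c'; rewrite (Prop_irrelevance c c'); apply: rst_refl.
- by move=> v v' _ IH u c c'; apply/rst_sym/IH.
- move=> u v w uv IH1 vw IH2 k c c'.
  have d : tgt k = @src P path_quiver v by rewrite c (path_eqv_src uv).
  by apply: rst_trans (IH1 _ _ d) (IH2 _ _ _).
Qed.

Lemma path_eqv_inv u v : path_eqv u v -> path_eqv (path_inv u) (path_inv v).
Proof.
elim=> {u v}.
- move=> u v [es et [w1 [l [w2 [e e']]]]]; apply: rst_step; split=> //=.
  exists (word_inv w2), l, (word_inv w1).
  rewrite e e' /word_inv !map_cat !rev_cat /= flipK !rev_cons -!cats1.
  by rewrite -!catA.
- by move=> u; apply: rst_refl.
- by move=> u v _ IH; apply: rst_sym.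
- by move=> u v w _ IH1 _ IH2; apply: rst_trans IH1 IH2.
Qed.

Lemma path_mulV u c : path_eqv (@path_mul u (path_inv u) c) (path_one (src u)).
Proof.
case: u c => p w q h /= c; move: c; rewrite /path_mul /=.
elim/last_ind: w q h => [|w l IH] q h c.
  apply: (@eq_ind _ _ (path_eqv _) (rst_refl _ _ _)).
  by apply: path_eq.
have hw : is_path p w (letter_src l).
  elim: w p h {IH c} => [|m w IHw] p /= [? h]; first by [].
  by split=> //; apply: IHw.
apply: rst_trans (IH _ hw erefl).
apply: rst_step; split=> //=.
exists w, l, (word_inv w); split=> //.
by rewrite /word_inv map_rcons rev_rcons -cats1 -catA.
Qed.

Lemma path_invK u : path_inv (path_inv u) = u.
Proof.
apply: path_eq => //=; rewrite /word_inv map_rev revK -map_comp.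
by rewrite (eq_map (g := id)) ?map_id //; apply: flipK.
Qed.

Definition free_pregroupoid : pregroupoid P.
Proof.
refine (@PreGroupoid P path_quiver path_eqv path_mul path_one path_inv
  (rst_refl _ _) (rst_sym _ _) (rst_trans _ _) path_eqv_src path_eqv_tgt
  _ path_eqv_inv (fun _ _ _ => erefl) (fun _ _ _ => erefl) (fun=> erefl)
  (fun=> erefl) (fun=> erefl) (fun=> erefl) _ _ _ _ _).
- move=> u u' v v' uv uv' eu ev.
  have c : tgt u' = src v by rewrite -(path_eqv_tgt eu).
  exact: rst_trans (path_eqv_mull _ c eu) (path_eqv_mulr _ _ ev).
- move=> u v w uv vw c d.
  have -> : path_mul d = path_mul c by apply: path_eq => //=; rewrite catA.
  exact: rst_refl.
- move=> u c; have -> : path_mul c = u by apply: path_eq.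
  exact: rst_refl.
- move=> u c; have -> : path_mul c = u by apply: path_eq => //=; rewrite cats0.
  exact: rst_refl.
- exact: path_mulV.
- move=> u c; have d : tgt (path_inv u) = src (path_inv (path_inv u)) by [].
  have -> : path_mul c = path_mul d.
    apply: path_eq => //=; congr cat.
    exact: (esym (congr1 path_word (path_invK u))).
  exact: path_mulV.
Defined.

Definition free_groupoid : groupoid P := class_groupoid free_pregroupoid.

Definition free_gen : qhom A free_groupoid :=
  qcomp (class_map free_pregroupoid)
    (@QHom P A path_quiver (fun a => path_letter (true, a))
       (fun=> erefl) (fun=> erefl)).

End Free.

Section StructureGroupoid.
Context (P : Type) (A : braided_quiver P).

(** The elements [x y (x <- y)^-1 (x -> y)^-1]. *)
Definition relator (r : free_groupoid A) : Prop :=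
  let i := free_gen A in
  exists (x y : A) (xy : tgt x = src y)
    (c1 : tgt (i x) = src (i y))
    (c2 : tgt (mul (i x) (i y) c1) = src (inv (i (rgt xy))))
    (c3 : tgt (mul (mul (i x) (i y) c1) (inv (i (rgt xy))) c2) =
          src (inv (i (lft xy)))),
    r = mul (mul (mul (i x) (i y) c1) (inv (i (rgt xy))) c2)
            (inv (i (lft xy))) c3.

Lemma relator_loop r : relator r -> src r = tgt r.
Proof.
move=> [x [y [xy [c1 [c2 [c3 ->]]]]]].
by rewrite !endE !qmap_src src_lft.
Qed.

Definition structure_groupoid : groupoid P :=
  quotient_groupoid (normal_closure_bundle relator_loop).

Definition structure_gen : qhom A structure_groupoid :=
  qcomp (quotient_map (normal_closure_bundle relator_loop)) (free_gen A).

End StructureGroupoid.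

(* Main.v *)
From mathcomp Require Import all_boot boolp.
Require Import Defs.

Set Implicit Arguments.
Unset Strict Implicit.
Unset Printing Implicit Defensive.

(** Both actions are encoded in squares [(f, g, u, v)], meaning [f -> g = u] and
    [f <- g = v].  For a map [K -> P], the bijections between fibres labelled by
    arrows of a groupoid [H] form a groupoid (a wreath product), and a cocycle
    over an action of [G] on [K] is the same as a morphism from [G] to it.  By
    the universal property of the structure groupoid, such a morphism is given
    by its values on generators.

    Used with [K] the generators, this extends [x <- a] and [x -> a] from a
    generator [a] to an arbitrary [g]; doing the same with the squares
    reflected, that is with [x] replaced by [x^-1], shows that [g |-> (x -> g)]
    is bijective.  Hence [x] acts by a labelled bijection on the arrows of the
    structure groupoid, and a second use with these as [K] extends [x] to an
    arbitrary [f].  The axioms hold on generators by the braid equation and are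
    stable under products and inverses.  The same induction shows that a
    morphism of braided quivers preserves all squares, which gives both
    uniqueness and universality. *)

(** * Groupoid multiplication as a total operation *)

Section TotalProduct.
Context (P : Type) (G : groupoid P).
Implicit Types (f g h : G) (p : P).

(** Junk value [f] when [f] and [g] are not composable. *)
Definition tmul f g : G :=
  if pselect (tgt f = src g) is left c then mul f g c else f.

Local Notation "f ** g" := (tmul f g) (at level 40, left associativity).

Lemma tmulE f g c : mul f g c = f ** g.
Proof.
rewrite /tmul; case: pselect => [d|//]; exact: mul_congr.
Qed.

Lemma src_tmul f g : tgt f = src g -> src (f ** g) = src f.
Proof. by move=> c; rewrite -(tmulE c) src_mul. Qed.

Lemma tgt_tmul f g : tgt f = src g -> tgt (f ** g) = tgt g.
Proof. by move=> c; rewrite -(tmulE c) tgt_mul. Qed.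

Lemma tmulA f g h : tgt f = src g -> tgt g = src h ->
  f ** (g ** h) = f ** g ** h.
Proof.
move=> fg gh.
have fg_h : tgt (mul f g fg) = src h by rewrite endE.
have f_gh : tgt f = src (mul g h gh) by rewrite endE.
by rewrite -(tmulE fg) -(tmulE gh) -(tmulE fg_h) -(tmulE f_gh) (mulA fg_h f_gh).
Qed.

Lemma tmul1g p f : src f = p -> one G p ** f = f.
Proof.
move=> <-; have c : tgt (one G (src f)) = src f by rewrite endE.
by rewrite -(tmulE c) mul1g.
Qed.

Lemma tmulg1 p f : tgt f = p -> f ** one G p = f.
Proof.
move=> <-; have c : tgt f = src (one G (tgt f)) by rewrite endE.
by rewrite -(tmulE c) mulg1.
Qed.

Lemma tmulgV f : f ** inv f = one G (src f).
Proof.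
have c : tgt f = src (inv f) by rewrite endE.
by rewrite -(tmulE c) mulgV.
Qed.

Lemma tmulVg f : inv f ** f = one G (tgt f).
Proof.
have c : tgt (inv f) = src f by rewrite endE.
by rewrite -(tmulE c) mulVg.
Qed.

Lemma tmulKg f g : tgt f = src g -> inv f ** (f ** g) = g.
Proof. by move=> c; rewrite tmulA ?endE // tmulVg tmul1g. Qed.

Lemma tmulKVg f g : src f = src g -> f ** (inv f ** g) = g.
Proof. by move=> c; rewrite tmulA ?endE // tmulgV tmul1g. Qed.

Lemma tmulgK f g : tgt f = src g -> f ** g ** inv g = f.
Proof. by move=> c; rewrite -tmulA ?endE // tmulgV tmulg1. Qed.

Lemma tmulgKV f g : tgt f = tgt g -> f ** inv g ** g = f.
Proof. by move=> c; rewrite -tmulA ?endE // tmulVg tmulg1. Qed.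

Lemma invMt f g : tgt f = src g -> inv (f ** g) = inv g ** inv f.
Proof.
move=> c; have d : tgt (inv g) = src (inv f) by rewrite !endE.
by rewrite -(tmulE c) (invM c d) tmulE.
Qed.

Lemma tmul_injl f g h :
  tgt f = src g -> tgt f = src h -> f ** g = f ** h -> g = h.
Proof. by move=> c d e; rewrite -(tmulKg c) e tmulKg. Qed.

Lemma tmul_injr f g h :
  tgt f = src h -> tgt g = src h -> f ** h = g ** h -> f = g.
Proof. by move=> c d e; rewrite -(tmulgK c) e tmulgK. Qed.

End TotalProduct.

Notation "f ** g" := (tmul f g) (at level 40, left associativity).

(** * Extensionality and basic properties of morphisms *)

Section Equalities.
Context (P : Type).

Lemma qhom_eq (A B : quiver P) (f g : qhom A B) : f =1 g -> f = g.
Proof.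
case: f g => [f fs ft] [g gs gt] /= /funext e.
by move: fs ft gs gt; rewrite e => *; congr QHom; apply: Prop_irrelevance.
Qed.

Lemma ghom_eq (G H : groupoid P) (f g : ghom G H) : f =1 g -> f = g.
Proof.
case: f g => [f f1 fM] [g g1 gM] /= /qhom_eq e.
by move: f1 fM g1 gM; rewrite e => *; congr GHom; apply: Prop_irrelevance.
Qed.

Lemma bghom_eq (G H : groupoid P) (B : braided_structure G)
  (C : braided_structure H) (f g : bghom B C) : f =1 g -> f = g.
Proof.
case: f g => [f fl fr] [g gl gr] /= /ghom_eq e.
by move: fl fr gl gr; rewrite e => *; congr BGHom; apply: Prop_irrelevance.
Qed.

End Equalities.

Section GroupoidMorphisms.
Context (P : Type) (G H : groupoid P) (F : ghom G H).

Lemma gmap_tmul f g : tgt f = src g -> F (f ** g) = F f ** F g.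
Proof.
move=> c; have d := qhom_composable F F c.
by rewrite -(tmulE c) -(tmulE d) -gmap_mul.
Qed.

Lemma gmap_inv f : F (inv f) = inv (F f).
Proof.
have d : tgt (inv f) = src f by rewrite endE.
have c := qhom_composable F F d.
apply: (inv_uniq (c := c)).
by rewrite tmulE -gmap_tmul // tmulVg gmap_one qmap_src src_inv.
Qed.

End GroupoidMorphisms.

(** * Universal properties of groupoids of classes and of free groupoids *)

Lemma class_map_tmul (P : Type) (G : pregroupoid P) (f g : G) c :
  class_map G (pmul f g c) = class_map G f ** class_map G g.
Proof.
have d := qhom_composable (class_map G) (class_map G) c.
by rewrite (class_map_mul c d) tmulE.
Qed.

Section ClassMorphisms.
Context (P : Type) (G : pregroupoid P) (H : groupoid P) (g : qhom G H).
Context (g_eqv : forall f f', eqv f f' -> g f = g f')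
  (g_one : forall p, g (pone G p) = one H p)
  (g_mul : forall f f' c, g (pmul f f' c) = g f ** g f').

(** [F] evaluates [g] at a chosen representative; [g_eqv] makes the choice immaterial, so
    multiplicativity can be checked on representatives. *)
Lemma class_ghom : exists F : ghom (class_groupoid G) H,
  forall f, F (class_map G f) = g f.
Proof.
pose r q := sval (cid (class_map_surj (G := G) q)).
have rK q : class_map G (r q) = q by rewrite /r; case: cid.
have Fs q : src (g (r q)) = src q.
  by rewrite qmap_src -{2}(rK q) (qmap_src (class_map G)).
have Ft q : tgt (g (r q)) = tgt q.
  by rewrite qmap_tgt -{2}(rK q) (qmap_tgt (class_map G)).
pose F := QHom Fs Ft.
have FE f : F (class_map G f) = g f by apply/g_eqv/class_map_eq; rewrite rK.
have F1 p : F (one _ p) = one H p by rewrite -class_map_one FE.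
have FM f f' fg fg' : F (mul f f' fg) = mul (F f) (F f') fg'.
  have c : tgt (r f) = src (r f').
    by rewrite -(qmap_tgt (class_map G)) -(qmap_src (class_map G)) !rK.
  rewrite (tmulE fg') -[RHS]/(g (r f) ** g (r f')) -(g_mul c) -FE.
  by congr (F _); rewrite class_map_tmul !rK tmulE.
by exists (GHom F1 FM).
Qed.

End ClassMorphisms.

Section FreeMorphisms.
Context (P : Type) (A : quiver P) (H : groupoid P) (phi : qhom A H).
Implicit Types (w : seq (letter A)) (l : letter A).

Definition eval_letter l : H := if l.1 then phi l.2 else inv (phi l.2).

(** An empty word does not determine its object, hence the base point [p], which moves along the
    word. *)
Fixpoint eval_word p w : H :=
  if w is l :: w' then eval_letter l ** eval_word (letter_tgt l) w'
  else one H p.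

Lemma src_eval_letter l : src (eval_letter l) = letter_src l.
Proof.
by case: l => [[] a]; rewrite /eval_letter /letter_src /=
  ?endE ?qmap_src ?qmap_tgt.
Qed.

Lemma tgt_eval_letter l : tgt (eval_letter l) = letter_tgt l.
Proof.
by case: l => [[] a]; rewrite /eval_letter /letter_tgt /=
  ?endE ?qmap_src ?qmap_tgt.
Qed.

Lemma eval_letter_flip l : eval_letter (flip l) = inv (eval_letter l).
Proof. by case: l => [[] a]; rewrite /eval_letter /= ?invK. Qed.

Lemma eval_word_ends p w q : is_path p w q ->
  src (eval_word p w) = p /\ tgt (eval_word p w) = q.
Proof.
elim: w p => [|l w IH] p /= => [->|[<- /IH [es et]]]; first by rewrite !endE.
have c : tgt (eval_letter l) = src (eval_word (letter_tgt l) w).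
  by rewrite tgt_eval_letter.
by rewrite src_tmul ?tgt_tmul ?src_eval_letter.
Qed.

Lemma is_path_catE p w1 w2 r : is_path p (w1 ++ w2) r ->
  exists q, is_path p w1 q /\ is_path q w2 r.
Proof.
elim: w1 p => [|l w1 IH] p /=; first by exists p.
by case=> e /IH [q [h1 h2]]; exists q.
Qed.

Lemma eval_word_cat p q r w1 w2 : is_path p w1 q -> is_path q w2 r ->
  eval_word p (w1 ++ w2) = eval_word p w1 ** eval_word q w2.
Proof.
move=> h1 h2; have [s2 t2] := eval_word_ends h2.
elim: w1 p h1 => [|l w1 IH] p /= => [->|[_ h]]; first by rewrite tmul1g.
have [s1 t1] := eval_word_ends h.
by rewrite IH // tmulA // ?tgt_eval_letter ?t1.
Qed.

Lemma eval_word_cancels (u v : path A) : cancels u v ->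
  eval_word (path_src u) (path_word u) = eval_word (path_src v) (path_word v).
Proof.
case: u v => [p w q h] [p' w' q' h'] [/= e1 e2 [w1 [l [w2 [ew ew']]]]].
move: h h'; rewrite {}ew {}ew' -{}e1 -{}e2 {w w' p' q'} => h h'.
have [r [h1 /= [er [es h2]]]] := is_path_catE h; move: h1 h2.
rewrite letter_tgt_flip er => h1 h2.
rewrite (eval_word_cat h1 h2).
(* The cancelling pair starts and ends at [r], so both words split at the same object and the pair
   evaluates to an identity there. *)
have h3 : is_path r [:: l, flip l & w2] q.
  by rewrite /= letter_src_flip letter_tgt_flip er.
rewrite (eval_word_cat h1 h3) /= eval_letter_flip letter_tgt_flip er; congr tmul.
have [s2 _] := eval_word_ends h2.
by rewrite tmulA ?endE ?src_eval_letter ?er ?s2 // tmulgV tmul1g ?src_eval_letter ?er.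
Qed.

Lemma free_ghom : exists F : ghom (free_groupoid A) H,
  forall a, F (free_gen A a) = phi a.
Proof.
pose ev (u : path_quiver A) := eval_word (path_src u) (path_word u).
have evs u : src (ev u) = src u by case: (eval_word_ends (pathP u)).
have evt u : tgt (ev u) = tgt u by case: (eval_word_ends (pathP u)).
have [F FE] : exists F : ghom (free_groupoid A) H,
    forall f, F (class_map (free_pregroupoid A) f) = QHom evs evt f.
  apply: class_ghom => //.
    move=> f f' ff'; suff: ev f = ev f' by [].
    elim: ff' => {f f'} [u v /eval_word_cancels|u|u v _ ->|u v w _ -> _ ->] //.
  move=> f f' c; have h := pathP f'.
  have e : path_tgt f = path_src f' by exact: c.
  by rewrite -e in h; rewrite /= /ev /= (eval_word_cat (pathP f) h) e.
exists F => a; rewrite /free_gen /= FE /= /ev /=.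
by rewrite /eval_letter /letter_tgt /= tmulg1 ?qmap_tgt.
Qed.

End FreeMorphisms.

(** A class is represented by a word; peeling off the first letter writes it as a product, and a
    letter is a generator or the inverse of one. *)
Lemma free_ind (P : Type) (A : quiver P) (Q : free_groupoid A -> Prop) :
  (forall p, Q (one _ p)) ->
  (forall f g, tgt f = src g -> Q f -> Q g -> Q (f ** g)) ->
  (forall f, Q f -> Q (inv f)) ->
  (forall a, Q (free_gen A a)) -> forall f, Q f.
Proof.
move=> Q1 QM QV Qg f; have [u <-] := class_map_surj f.
case: u => p w q; elim: w p => [|l w IH] p h.
  have e : path_one A p = Path h by apply: path_eq.
  by rewrite -e; apply: Q1.
have [es hw] := h.
pose F := free_pregroupoid A; pose u : F := path_letter l; pose v : F := Path hw.
have c : tgt u = src v by [].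
have -> : Path h = pmul u v c by apply: path_eq.
rewrite class_map_tmul; apply: QM; [| |exact: IH].
  by rewrite (qmap_tgt (class_map F)) (qmap_src (class_map F)).
case: l @u {h es hw v c} => [[] a] u; first exact: Qg.
have <- : inv (free_gen A a) = class_map F u; last exact/QV/Qg.
rewrite /free_gen -[LHS](class_map_inv (G := F)).
congr (class_map _ _); exact: path_eq.
Qed.

(** * The braiding as a relation on squares *)

Section SquareRelation.
Context (P : Type).

(** The proof of composability is hidden under the existential, so that equations between arrows can
    be rewritten without dependent types. *)
Definition sq (A : braided_quiver P) (x y u v : A) : Prop :=
  exists c : tgt x = src y, lft c = u /\ rgt c = v.

Section Quiver.
Context (A : braided_quiver P).
Implicit Types x y u v : A.

Lemma sq_ends x y u v : sq x y u v ->
  [/\ tgt x = src y, src u = src x, tgt v = tgt y & tgt u = src v].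
Proof.
by case=> c [<- <-]; rewrite src_lft tgt_rgt tgt_lft.
Qed.

Lemma sq_total x y : tgt x = src y -> exists u v, sq x y u v.
Proof. by move=> c; exists (lft c), (rgt c), c. Qed.

Lemma sq_fun x y u v u' v' : sq x y u v -> sq x y u' v' -> u = u' /\ v = v'.
Proof. by case=> c [<- <-] [d [<- <-]]; rewrite (Prop_irrelevance c d). Qed.

Lemma sq_braidE x y u v (c : tgt x = src y) (d : tgt u = src v) :
  sq x y u v <-> braid A (qpair c) = qpair d.
Proof.
split=> [[c' [e1 e2]]|e].
  by rewrite (Prop_irrelevance c c'); apply: qprod_eq.
by exists c; rewrite /lft /rgt e.
Qed.

Lemma sq_totalV u v : tgt u = src v -> exists x y, sq x y u v.
Proof.
move=> d; have [g _ gK] := braid_bij A; exists (sval (g (qpair d))).1.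
exists (sval (g (qpair d))).2; have c := proj2_sig (g (qpair d)).
by apply/(sq_braidE c d); rewrite -[RHS]gK; congr (braid A _); apply: qprod_eq.
Qed.

Lemma sq_funV x y u v x' y' : sq x y u v -> sq x' y' u v -> x = x' /\ y = y'.
Proof.
move=> s s'; have [c _ _ d] := sq_ends s; have [c' _ _ _] := sq_ends s'.
move/(sq_braidE c d): s; move/(sq_braidE c' d): s' => <-.
by move/(bij_inj (braid_bij A)) => [].
Qed.

(** The hypotheses compute one side of the braid equation on [(x, y, z)], with value [(e, f, d)];
    the conclusion displays the intermediate squares of the other side. *)
Lemma sq_yang_baxter x y z a b c d e f :
  sq x y a b -> sq b z c d -> sq a c e f ->
  exists y' z' w, [/\ sq y z y' z', sq x y' e w & sq w z' f d].
Proof.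
move=> s1 s2 s3; have [xy _ by_ ab] := sq_ends s1; have [bz _ _ cd] := sq_ends s2.
have [ac _ fc ef] := sq_ends s3.
have yz : tgt y = src z by rewrite -by_.
have [y' [z' sy]] := sq_total yz; have [_ y'y _ yz'] := sq_ends sy.
have xy' : tgt x = src y' by rewrite y'y.
have [e' [w sx]] := sq_total xy'; have [_ _ wy' ew] := sq_ends sx.
have wz' : tgt w = src z' by rewrite wy'.
have [f' [d' sw]] := sq_total wz'; have [_ _ _ fd] := sq_ends sw.
have h := @braidP P A (@qpair P (qprod A A) A (qpair xy) z yz).
(* [k] and [l] evaluate the two factors of the braid equation on a composable triple, given the
   square that is used. *)
have k x1 y1 z1 (xy1 : tgt x1 = src y1) (yz1 : tgt y1 = src z1) u1 v1
  (uv1 : tgt u1 = src v1) (vz1 : tgt v1 = src z1) : sq x1 y1 u1 v1 ->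
  qprod_map (braid A) (qid A) (@qpair P (qprod A A) A (qpair xy1) z1 yz1) =
  @qpair P (qprod A A) A (qpair uv1) z1 vz1.
  by move=> /(sq_braidE xy1 uv1) s; apply: qprod_eq.
have l x1 y1 z1 (xy1 : tgt x1 = src y1) (yz1 : tgt y1 = src z1) u1 v1
  (xu1 : tgt x1 = src u1) (uv1 : tgt u1 = src v1) : sq y1 z1 u1 v1 ->
  qcomp (qassocV A A A) (qcomp (qprod_map (qid A) (braid A)) (qassoc A A A))
    (@qpair P (qprod A A) A (qpair xy1) z1 yz1) =
  @qpair P (qprod A A) A (qpair xu1) v1 uv1.
  move=> [t [e1 e2]]; apply: qprod_eq => /=; rewrite (Prop_irrelevance yz1 t) //.
  exact: qprod_eq.
rewrite (k _ _ _ _ _ _ _ ab bz s1) in h.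
rewrite (l _ _ _ _ _ _ _ ac cd s2) in h.
have fd' : tgt f = src d by rewrite fc.
rewrite (k _ _ _ _ _ _ _ ef fd' s3) in h.
rewrite (l _ _ _ _ _ _ _ xy' yz' sy) in h.
rewrite (k _ _ _ _ _ _ _ ew wz' sx) in h.
have ef' : tgt e' = src f'.
  by have [_ -> _ _] := sq_ends sw.
rewrite (l _ _ _ _ _ _ _ ef' fd sw) in h.
exists y', z', w; split=> //; move: (congr1 sval h) => -[e1 e2 e3]; by congruence.
Qed.

End Quiver.

Lemma braided_morphismP (A B : braided_quiver P) (T : qhom A B) :
  is_braided_morphism T <->
  forall x y u v : A, sq x y u v -> sq (T x) (T y) (T u) (T v).
Proof.
split=> [h x y u v s|h].
  have [c _ _ d] := sq_ends s; move/(sq_braidE c d): s => s.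
  have c' := qhom_composable T T c; have d' := qhom_composable T T d.
  apply/(sq_braidE c' d').
  have -> : qpair c' = qprod_map T T (qpair c) by apply: qprod_eq.
  by rewrite -h s; apply: qprod_eq.
case=> [[x y] /= c].
have s : sq x y (lft c) (rgt c) by exists c.
have [d [e1 e2]] := h _ _ _ _ s.
have e : qprod_map T T (qpair c) = qpair d by apply: qprod_eq.
apply: etrans (esym (congr1 (braid B) e)); exact: qprod_eq.
Qed.

End SquareRelation.

(** * Universal property of the structure groupoid *)

Lemma kernel_bundle (P : Type) (G H : groupoid P) (F : ghom G H) :
  normal_bundle (fun f => src f = tgt f /\ F f = one H (src f)).
Proof.
split=> [f []//|p|f g c [ef hf] [eg hg]|f [ef hf]|f n fn c [en hn]].
- by rewrite gmap_one !endE.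
- rewrite tmulE src_tmul // tgt_tmul // gmap_tmul // hf hg ef c.
  by rewrite tmul1g ?endE.
- by rewrite gmap_inv hf !endE inv_one -ef.
- rewrite !tmulE src_tmul ?tgt_tmul ?src_tmul ?endE -?en // gmap_tmul; last first.
    by rewrite tgt_tmul ?endE -?en.
  rewrite gmap_tmul // gmap_inv hn tmulg1 ?qmap_tgt // tmulgV qmap_src.
  by split.
Qed.

Section StructureMorphisms.
Context (P : Type) (A : braided_quiver P).
Local Notation GA := (structure_groupoid A).
Local Notation io := (structure_gen A).
Let Q := quotient_pregroupoid (normal_closure_bundle (@relator_loop P A)).
Local Notation gen := (free_gen A).

(** The quotient of the two products is a relator, because [inv (u ** v)] is [inv v ** inv u]. *)
Lemma structure_gen_sq x y u v : sq x y u v -> io x ** io y = io u ** io v.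
Proof.
move=> s; have [xy ux vy uv] := sq_ends s.
have xy' := qhom_composable gen gen xy; have uv' := qhom_composable gen gen uv.
transitivity (class_map Q (mul (gen x) (gen y) xy')).
  exact: (esym (class_map_tmul (G := Q) xy')).
transitivity (class_map Q (mul (gen u) (gen v) uv')); last first.
  exact: (class_map_tmul (G := Q) uv').
apply/class_map_eq.
have c : tgt (mul (gen x) (gen y) xy') = src (inv (mul (gen u) (gen v) uv')).
  by rewrite !endE !qmap_tgt.
exists c => N _; apply; case: s => d [eu ev]; move: uv' c; rewrite -eu -ev => uv' c.
have c2 : tgt (mul (gen x) (gen y) xy') = src (inv (gen (rgt d))).
  by rewrite !endE !qmap_tgt tgt_rgt.
have c3 : tgt (mul (mul (gen x) (gen y) xy') (inv (gen (rgt d))) c2) =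
          src (inv (gen (lft d))).
  by rewrite !endE qmap_tgt qmap_src tgt_lft.
exists x, y, d, xy', c2, c3; rewrite (tmulE c) (tmulE c3) (tmulE c2) (tmulE uv').
by rewrite invMt // tmulA // !endE !qmap_tgt ?qmap_src ?tgt_rgt ?tgt_lft.
Qed.

(** The kernel of the extension of [phi] to the free groupoid is a normal bundle containing the
    relators, so it contains their normal closure and the extension is constant on classes. *)
Lemma structure_ghom (H : groupoid P) (phi : qhom A H) :
  (forall x y u v, sq x y u v -> phi x ** phi y = phi u ** phi v) ->
  exists F : ghom GA H, forall x, F (io x) = phi x.
Proof.
move=> phi_sq; have [F0 F0E] := free_ghom phi.
have [f f' [c n]|p|f f' c|F FE] := @class_ghom P Q H F0.
(* Membership in the normal closure is instantiated at the kernel of [F0]; the relators lie in it by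
   [phi_sq]. *)
- have [r [x [y [xy [c1 [c2 [c3 ->]]]]]]|_] := n _ (kernel_bundle F0).
    split; first by rewrite !endE !qmap_src src_lft.
    have s : sq x y (lft xy) (rgt xy) by exists xy.
    have [_ ux vy uv] := sq_ends s.
    have c5 := qhom_composable phi phi uv.
    rewrite !src_mul qmap_src (tmulE c3) (gmap_tmul _ c3) (tmulE c2).
    rewrite (gmap_tmul _ c2) (tmulE c1) (gmap_tmul _ c1) !gmap_inv !F0E.
    by rewrite (phi_sq _ _ _ _ s) tmulgK // tmulgV qmap_src ux.
  rewrite tmulE gmap_tmul // gmap_inv => e.
  have d : tgt (F0 f) = src (inv (F0 f')) by rewrite endE !qmap_tgt c endE.
  have := inv_uniq (c := d); rewrite tmulE e invK; apply.
  by rewrite src_tmul // qmap_src.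
- exact: gmap_one.
- by rewrite [pmul _ _ _]tmulE gmap_tmul.
- by exists F => x; rewrite -F0E -FE.
Qed.

Lemma structure_ind (R : GA -> Prop) :
  (forall p, R (one _ p)) ->
  (forall f g, tgt f = src g -> R f -> R g -> R (f ** g)) ->
  (forall f, R f -> R (inv f)) ->
  (forall a, R (io a)) -> forall f, R f.
Proof.
move=> R1 RM RV Rg f; have [w <-] := @class_map_surj P Q f.
elim/free_ind: w => [p|u v c hu hv|u hu|a]; last exact: Rg.
- exact: R1.
- rewrite -(tmulE c) [class_map _ _](class_map_tmul (G := Q) c); apply: RM => //.
  by rewrite (qmap_tgt (class_map Q)) (qmap_src (class_map Q)).
- by rewrite [class_map _ _](class_map_inv (G := Q)); apply: RV.
Qed.

End StructureMorphisms.

(** * The wreath product groupoid of labelled bijections *)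

Section Wreath.
Context (P K : Type) (m n : K -> P) (H : groupoid P).
Implicit Types (p q r : P) (k l : K) (u v : H).

(** [R k u l] reads: [k] is sent to [l] with label [u]. The map [m] selects the fibres and [n] gives
    the ends of the labels. *)
Record labelled_bijection p q (R : K -> H -> K -> Prop) : Prop := {
  lb_ends : forall k u l, R k u l ->
    [/\ m k = p, m l = q, src u = n k & tgt u = n l];
  lb_total : forall k, m k = p -> exists u l, R k u l;
  lb_totalV : forall l, m l = q -> exists k u, R k u l;
  lb_fun : forall k u l v l', R k u l -> R k v l' -> u = v /\ l = l';
  lb_funV : forall k u l v k', R k u l -> R k' v l -> u = v /\ k = k' }.

Record wreath_arrow := WreathArrow {
  wsrc : P;
  wtgt : P;
  wrel : K -> H -> K -> Prop;
  wrelP : labelled_bijection wsrc wtgt wrel }.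

Definition wreath_quiver : quiver P := Quiver wsrc wtgt.
Implicit Types f g : wreath_quiver.

(** One inclusion suffices: an element related by [g] also has an image under [f], which by
    inclusion is an image under [g], and images and labels under [g] are unique. *)
Lemma wreath_eq f g : src f = src g -> tgt f = tgt g ->
  (forall k u l, wrel f k u l -> wrel g k u l) -> f = g.
Proof.
case: f g => [p q R hR] [p' q' S hS] /= ep eq RS.
have e : R = S.
  apply/funext => k; apply/funext => u; apply/funext => l; apply/propext.
  split=> [/RS //|s]; have [mk _ _ _] := lb_ends hS s.
  rewrite -ep in mk; have [v [l' r]] := lb_total hR mk.
  by have [-> ->] := lb_fun hS s (RS _ _ _ r).
move: hR hS; rewrite ep eq e => hR hS.
by congr WreathArrow; apply: Prop_irrelevance.
Qed.

Lemma wreath_mulP f g : tgt f = src g -> labelled_bijection (src f) (tgt g)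
  (fun k w l => exists u j v, [/\ wrel f k u j, wrel g j v l & w = u ** v]).
Proof.
case: f g => [p q R hR] [p' r S hS] /= c; move: hS; rewrite -{}c => hS {p'}.
split=> [k w l [u [j [v [rr ss ->]]]]|k mk|l ml||].
- have [? mj su tu] := lb_ends hR rr; have [_ ? sv tv] := lb_ends hS ss.
  by rewrite src_tmul ?tgt_tmul ?tu.
- have [u [j rr]] := lb_total hR mk; have [_ mj _ _] := lb_ends hR rr.
  have [v [l ss]] := lb_total hS mj.
  by exists (u ** v), l, u, j, v.
- have [j [v ss]] := lb_totalV hS ml; have [mj _ _ _] := lb_ends hS ss.
  have [k [u rr]] := lb_totalV hR mj.
  by exists k, (u ** v), u, j, v.
- move=> k _ l _ l' [u [j [v [rr ss ->]]]] [u' [j' [v' [rr' ss' ->]]]].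
  have [-> ej] := lb_fun hR rr rr'; rewrite -{}ej in ss'.
  by have [-> ->] := lb_fun hS ss ss'.
- move=> k _ l _ k' [u [j [v [rr ss ->]]]] [u' [j' [v' [rr' ss' ->]]]].
  have [-> ej] := lb_funV hS ss ss'; rewrite -{}ej in rr'.
  by have [-> ->] := lb_funV hR rr rr'.
Qed.

Definition wreath_mul f g (c : tgt f = src g) : wreath_quiver :=
  WreathArrow (wreath_mulP c).

Lemma wreath_oneP p : labelled_bijection p p
  (fun k u l => [/\ m k = p, u = one H (n k) & k = l]).
Proof.
split.
- by move=> k u l [? -> <-]; rewrite !endE.
- by move=> k mk; exists (one H (n k)), k.
- by move=> k mk; exists k, (one H (n k)).
- by move=> k u l v l' [_ -> <-] [_ -> <-].
- by move=> k u l v k' [_ -> ->] [_ -> ->].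
Qed.

Definition wreath_one p : wreath_quiver := WreathArrow (wreath_oneP p).

Lemma wreath_invP f : labelled_bijection (tgt f) (src f)
  (fun k u l => wrel f l (inv u) k).
Proof.
case: f => [p q R hR] /=; split.
- by move=> k u l /(lb_ends hR) []; rewrite !endE => ? ? ? ?; split.
- move=> k mk; have [l [u r]] := lb_totalV hR mk.
  by exists (inv u), l; rewrite invK.
- move=> k mk; have [u [l r]] := lb_total hR mk.
  by exists l, (inv u); rewrite invK.
- move=> k u l v l' r r'; have [e ->] := lb_funV hR r r'.
  by rewrite -(invK u) e invK.
- move=> k u l v l' r r'; have [e ->] := lb_fun hR r r'.
  by rewrite -(invK u) e invK.
Qed.

Definition wreath_inv f : wreath_quiver := WreathArrow (wreath_invP f).

Definition wreath : groupoid P.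
Proof.
refine (@Groupoid P wreath_quiver wreath_mul wreath_one wreath_inv
  (fun _ _ _ => erefl) (fun _ _ _ => erefl) (fun=> erefl) (fun=> erefl)
  (fun=> erefl) (fun=> erefl) _ _ _ _ _).
- move=> f g h fg gh fg_h f_gh; apply: wreath_eq => //= k w' l.
  case=> [u [i [vw [ruv [v [j [w [rv rw ->]]]] ->]]]].
  have [_ _ _ tu] := lb_ends (wrelP f) ruv.
  have [_ _ sv tv] := lb_ends (wrelP g) rv.
  have [_ _ sw _] := lb_ends (wrelP h) rw.
  exists (u ** v), j, w; split=> //; first by exists u, i, v.
  by rewrite tmulA ?tu ?tv.
- move=> f c; apply: wreath_eq => //= k w l [e [i [u [[_ -> <-] r ->]]]].
  have [_ _ su _] := lb_ends (wrelP f) r.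
  by rewrite tmul1g.
- move=> f c; apply: wreath_eq => //= k w l [u [j [e [r [_ -> <-] ->]]]].
  have [_ _ _ tu] := lb_ends (wrelP f) r.
  by rewrite tmulg1.
- move=> f c; apply: wreath_eq => //= k w l [u [j [v [r r' ->]]]].
  have [mk _ su _] := lb_ends (wrelP f) r; have [e ek] := lb_funV (wrelP f) r r'.
  by rewrite -(invK v) -e tmulgV su.
- move=> f c; apply: wreath_eq => //= k w l [u [j [v [r r' ->]]]].
  have [_ mk _ tu] := lb_ends (wrelP f) r; have [e ek] := lb_fun (wrelP f) r r'.
  by rewrite -e tmulgV; split=> //; rewrite -tu endE.
Defined.

Lemma wreath_ext (f g : wreath) : src f = src g -> tgt f = tgt g ->
  (forall k u l, wrel f k u l -> wrel g k u l) -> f = g.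
Proof. exact: wreath_eq. Qed.

Lemma wreath_mulE (f g : wreath) k w l : tgt f = src g ->
  wrel (f ** g) k w l <->
  exists u j v, [/\ wrel f k u j, wrel g j v l & w = u ** v].
Proof. by move=> c; rewrite -(tmulE c). Qed.

End Wreath.

(** Inclusion of relations suffices because both sides are labelled bijections
    with the same fibres. *)
Lemma structure_wreath (P : Type) (A : braided_quiver P) (K : Type)
    (m n : K -> P) (H : groupoid P) (R : A -> K -> H -> K -> Prop) :
  (forall x, labelled_bijection m n (src x) (tgt x) (R x)) ->
  (forall x y x' y' k j l u v, sq x y x' y' -> R x k u j -> R y j v l ->
    exists u' j' v', [/\ R x' k u' j', R y' j' v' l & u ** v = u' ** v']) ->
  exists F : ghom (structure_groupoid A) (wreath m n H),
    forall x, wrel (F (structure_gen A x)) = R x.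
Proof.
move=> RP Rsq; pose phi := @QHom P A (wreath m n H)
  (fun x => WreathArrow (RP x)) (fun=> erefl) (fun=> erefl).
have [|F FE] := structure_ghom (phi := phi).
  move=> x y u v s; have [xy ux vy uv] := sq_ends s.
  apply: wreath_ext; rewrite ?src_tmul ?tgt_tmul // => k w l.
  case/wreath_mulE=> // u1 [j [v1 [r1 r2 ->]]]; apply/wreath_mulE => //.
  by have [u' [j' [v' [r1' r2' ->]]]] := Rsq _ _ _ _ _ _ _ _ _ s r1 r2;
    exists u', j', v'.
by exists F => x; rewrite FE.
Qed.

Section WreathMorphisms.
Context (P K : Type) (m n : K -> P) (G H : groupoid P).
Context (F : ghom G (wreath m n H)).

Lemma wrel_ends f k u l : wrel (F f) k u l ->
  [/\ m k = src f, m l = tgt f, src u = n k & tgt u = n l].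
Proof.
move=> /(lb_ends (wrelP (F f))) [-> -> -> ->]; split=> //.
  exact: (qmap_src F f).
exact: (qmap_tgt F f).
Qed.

Lemma wrel_total f k : m k = src f -> exists u l, wrel (F f) k u l.
Proof.
move=> e; apply: (lb_total (wrelP (F f))); rewrite e.
exact: (esym (qmap_src F f)).
Qed.

Lemma wrel_totalV f l : m l = tgt f -> exists k u, wrel (F f) k u l.
Proof.
move=> e; apply: (lb_totalV (wrelP (F f))); rewrite e.
exact: (esym (qmap_tgt F f)).
Qed.

Lemma wrel_tmul f g k w l : tgt f = src g -> wrel (F (f ** g)) k w l <->
  exists u j v, [/\ wrel (F f) k u j, wrel (F g) j v l & w = u ** v].
Proof.
by move=> c; rewrite gmap_tmul // wreath_mulE ?qmap_src ?qmap_tgt.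
Qed.

Lemma wrel_one p k u l :
  wrel (F (one G p)) k u l <-> [/\ m k = p, u = one H (n k) & k = l].
Proof. by rewrite gmap_one. Qed.

Lemma wrel_inv f k u l : wrel (F (inv f)) k u l <-> wrel (F f) l (inv u) k.
Proof. by rewrite gmap_inv. Qed.

End WreathMorphisms.

(** Otherwise simplification unfolds [src] and [tgt] on equivalence classes. *)
Opaque structure_groupoid structure_gen.

(** * Completing squares by non-degeneracy *)

Section Nondegenerate.
Context (P : Type) (A : braided_quiver P) (A_nondeg : nondegenerate A).
Implicit Types x y u v : A.

(** Surjectivity of [lft_map x]; injectivity gives the uniqueness that follows, and [rgt_map] gives
    the mirror pair of statements. *)
Lemma sq_left_total x u : src x = src u -> exists y v, sq x y u v.
Proof.
move=> e; have [[g gK Kg] _] := A_nondeg x.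
pose y := g (exist _ u (esym e)); exists (sval y), (rgt (esym (proj2_sig y))).
exists (esym (proj2_sig y)); split=> //.
exact: (congr1 sval (Kg (exist _ u (esym e)))).
Qed.

Lemma sq_left_fun x y u v y' v' :
  sq x y u v -> sq x y' u v' -> y = y' /\ v = v'.
Proof.
move=> s s'; suff e : y = y' by move: s'; rewrite -e => /(sq_fun s) [].
case: s s' => c [e _] [c' [e' _]]; have [/bij_inj inj _] := A_nondeg x.
have := inj (exist _ y (esym c)) (exist _ y' (esym c')).
move=> /(_ _)/(congr1 sval) /=; apply; apply: sval_inj; rewrite /=.
rewrite (Prop_irrelevance (esym (esym c)) c) (Prop_irrelevance (esym (esym c')) c').
by rewrite e e'.
Qed.

Lemma sq_right_total y v : tgt y = tgt v -> exists x u, sq x y u v.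
Proof.
move=> e; have [_ [g gK Kg]] := A_nondeg y.
pose x := g (exist _ v (esym e)); exists (sval x), (lft (proj2_sig x)).
exists (proj2_sig x); split=> //.
exact: (congr1 sval (Kg (exist _ v (esym e)))).
Qed.

Lemma sq_right_fun x y u v x' u' :
  sq x y u v -> sq x' y u' v -> u = u' /\ x = x'.
Proof.
move=> s s'; suff e : x = x' by move: s'; rewrite -e => /(sq_fun s) [].
case: s s' => c [_ e] [c' [_ e']]; have [_ /bij_inj inj] := A_nondeg y.
have := inj (exist _ x c) (exist _ x' c').
by move=> /(_ _)/(congr1 sval) /=; apply; apply: sval_inj; rewrite /= e e'.
Qed.

End Nondegenerate.

(** * Squares in the structure groupoid, first for generators against arrows, then for all arrows *)

Section Extension.
Context (P : Type) (A : braided_quiver P) (A_nondeg : nondegenerate A).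
Implicit Types (a x y : A) (f g h u v w : structure_groupoid A).
Local Notation GA := (structure_groupoid A).
Local Notation io := (structure_gen A).

Definition ends (b : bool) (x : A) : P := if b then tgt x else src x.

(** The edge [x] is carried past the generator [a] to [y]. For [b = false] the roles of [a] and [u]
    are exchanged, since [x -> u = a] amounts to [x^-1 -> a = u]. *)
Definition gen_sq b (a x : A) (w : GA) (y : A) : Prop :=
  exists u : A, (if b then sq x a u y else sq x u a y) /\ w = io u.

(** For [b = true] the inverse direction is right non-degeneracy; for [b = false] the forward
    direction is left non-degeneracy and the inverse one is bijectivity of the braiding. *)
Lemma gen_sqP b a :
  labelled_bijection (ends b) (ends (~~ b)) (src a) (tgt a) (gen_sq b a).
Proof.
case: b; rewrite /gen_sq /ends /=; split.
- by move=> x _ y [u [/sq_ends [? ? ? ?] ->]]; rewrite qmap_src qmap_tgt.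
- by move=> x /sq_total [u [y s]]; exists (io u), y, u.
- by move=> y /esym /(sq_right_total A_nondeg) [x [u s]]; exists x, (io u), u.
- by move=> x _ y _ y' [u [s ->]] [u' [s' ->]];
  have [-> ->] := sq_fun s s'.
- by move=> x _ y _ x' [u [s ->]] [u' [s' ->]];
  have [-> ->] := sq_right_fun A_nondeg s s'.
- by move=> x _ y [u [/sq_ends [? ? ? ?] ->]]; rewrite qmap_src qmap_tgt.
- by move=> x /(sq_left_total A_nondeg) [u [y s]]; exists (io u), y, u.
- by move=> y /esym /sq_totalV [x [u s]]; exists x, (io u), u.
- by move=> x _ y _ y' [u [s ->]] [u' [s' ->]];
  have [-> ->] := sq_left_fun A_nondeg s s'.
- by move=> x _ y _ x' [u [s ->]] [u' [s' ->]];
  have [-> ->] := sq_funV s s'.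
Qed.

Lemma gen_ghom b : exists F : ghom GA (wreath (ends b) (ends (~~ b)) GA),
  forall a, wrel (F (io a)) = gen_sq b a.
Proof.
apply: structure_wreath (gen_sqP b) _ => a1 a2 a1' a2' k j l u0 v0 s.
case: b => -[u [s1 ->]] [v [s2 ->]].
  have [_ _ _ uj] := sq_ends s1; have [_ vj _ _] := sq_ends s2.
  have uv : tgt u = src v by rewrite uj vj.
  (* The labels along [a1'] and [a2'] are found by braiding the labels [u] and [v]; the braid
     equation confirms this, and the two products of labels agree by the defining relation. *)
  have [e [f s3]] := sq_total uv.
  have [y [z [w [/(sq_fun s) [<- <-] s4 s5]]]] := sq_yang_baxter s1 s2 s3.
  exists (io e), w, (io f); split; [by exists e | by exists f |].
  exact: structure_gen_sq.
have [y [z [w [s3 s4 s5]]]] := sq_yang_baxter s1 s2 s.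
exists (io y), w, (io z); split; [by exists y | by exists z |].
exact: structure_gen_sq.
Qed.

Definition edge b : ghom GA (wreath (ends b) (ends (~~ b)) GA) :=
  sval (cid (gen_ghom b)).

(** [edge_sq true g x u y] says that [x -> g = u] and [x <- g = y], and
    [edge_sq false g x u y] says the same of [x^-1] and [y^-1]. *)
Definition edge_sq b (g : GA) (x : A) (u : GA) (y : A) : Prop :=
  wrel (edge b g) x u y.

Lemma edge_sq_gen b a x w y : edge_sq b (io a) x w y <-> gen_sq b a x w y.
Proof. by rewrite /edge_sq /edge; case: cid => F /= ->. Qed.

(** Arrows and labels compose and invert in the same way, so exchanging [g] with [u] need only be
    checked on generators, where both readings are the same square. This is what inverts
    [x -> _]. *)
Lemma edge_sq_flip b g x u y : edge_sq b g x u y -> edge_sq (~~ b) u x g y.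
Proof.
elim/structure_ind: g b x u y => [p|f g c IHf IHg|f IH|a] b x u y.
- move=> /wrel_one [mk -> <-]; apply/wrel_one; split=> //.
  by rewrite negbK mk.
- move=> /wrel_tmul [//|u1 [j [u2 [e1 e2 ->]]]].
  have [_ _ _ tu] := wrel_ends e1; have [_ _ su _] := wrel_ends e2.
  apply/wrel_tmul; first by rewrite tu su.
  by exists f, j, g; split=> //; [apply: IHf | apply: IHg].
- move=> /wrel_inv /IH h; rewrite -(invK u); apply/wrel_inv.
  by rewrite invK.
- move/edge_sq_gen => [v [s ->]]; apply/edge_sq_gen; exists a; split=> //.
  by case: b s.
Qed.

(** The braid equation for two generators and an arbitrary third arrow; it makes the action of
    generators on arrows respect the defining relations. *)
Lemma edge_sq_sq g x y x' y' g1 g2 x1 y1 : sq x y x' y' ->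
  edge_sq true g y g1 y1 -> edge_sq true g1 x g2 x1 ->
  exists g1' x1' y1',
    [/\ edge_sq true g y' g1' y1', edge_sq true g1' x' g2 x1'
      & sq x1 y1 x1' y1'].
Proof.
elim/structure_ind: g x y x' y' g1 g2 x1 y1 =>
  [p|f h c IHf IHh|f IH|a] x y x' y' g1 g2 x1 y1 s.
- have [xy sx ty xy'] := sq_ends s.
  move=> /wrel_one [my -> <-] /wrel_one [mx -> <-].
  exists (one _ (src y')), x', y'; split=> //; apply/wrel_one; split=> //=.
    by rewrite -my.
  by rewrite /= sx.
- move=> /wrel_tmul [//|a [j [b [ea eb ->]]]].
  have [_ _ _ ta] := wrel_ends ea; have [_ _ sb _] := wrel_ends eb.
  move=> /wrel_tmul []; first by rewrite ta sb.
  move=> c' [i [d [ec ed ->]]].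
  have [a' [i' [j' [ea' ec' s1]]]] := IHf _ _ _ _ _ _ _ _ s ea ec.
  have [b' [x1' [y1' [eb' ed' s2]]]] := IHh _ _ _ _ _ _ _ _ s1 eb ed.
  have [_ _ _ ta'] := wrel_ends ea'; have [_ _ sb' _] := wrel_ends eb'.
  exists (a' ** b'), x1', y1'; split=> //; apply/wrel_tmul.
  + by [].
  + by exists a', j', b'.
  + by rewrite ta' sb'.
  + by exists c', i', d.
(* For an inverse the far pair [(x1, y1)] is braided first; the induction hypothesis leads back to
   [(x, y)], whose braiding is already known to be [(x', y')]. *)
- move=> e1 e2; have [_ _ _ t1] := wrel_ends e1; have [_ t2 _ _] := wrel_ends e2.
  have c1 : tgt x1 = src y1 by exact: etrans t2 t1.
  have [x1' [y1' s1]] := sq_total c1.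
  move/wrel_inv: e1 => e1; rewrite -(invK g1) in e2; move/wrel_inv: e2 => e2.
  have [g' [x'' [y'' [e1' e2']]]] := IH _ _ _ _ _ _ _ _ s1 e1 e2.
  move/(sq_fun s) => [ex ey]; rewrite -{}ex in e2'; rewrite -{}ey in e1'.
  exists (inv g'), x1', y1'; split=> //; apply/wrel_inv => //.
  by rewrite invK.
- move=> /edge_sq_gen [u [su ->]] /edge_sq_gen [v [sv ->]].
  have [xy _ ty xy'] := sq_ends s; have [ya _ _ _] := sq_ends su.
  have ya' : tgt y' = src a by rewrite ty.
  have [u' [d s1]] := sq_total ya'; have [_ u'y _ _] := sq_ends s1.
  have xu' : tgt x' = src u' by rewrite u'y.
  have [e [f s2]] := sq_total xu'.
  (* The braid equation for [(x, y, a)]; functionality identifies the squares of its other side with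
     the given ones. *)
  have [y2 [z2 [w [h1 h2 h3]]]] := sq_yang_baxter s s1 s2.
  have [ey ez] := sq_fun su h1; rewrite -{}ey in h2; rewrite -{}ez in h3.
  have [ev ew] := sq_fun sv h2; rewrite -{}ew in h3.
  exists (io u'), f, d; split=> //; apply/edge_sq_gen; first by exists u'.
  by exists e; rewrite ev.
Qed.

Lemma edge_sq_tmul g x u y : edge_sq true g x u y -> io x ** g = u ** io y.
Proof.
elim/structure_ind: g x u y => [p|f g c IHf IHg|f IH|a] x u y.
- move=> /wrel_one [<- -> <-].
  by rewrite tmulg1 ?tmul1g ?qmap_src ?qmap_tgt.
- move=> /wrel_tmul [//|u1 [j [u2 [e1 e2 ->]]]].
  have [/= m1 m2 m3 m4] := wrel_ends e1; have [/= m5 m6 m7 m8] := wrel_ends e2.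
  rewrite tmulA ?qmap_tgt // (IHf _ _ _ e1) -tmulA ?qmap_src ?qmap_tgt //.
  by rewrite (IHg _ _ _ e2) tmulA ?qmap_src // m4 m7.
- move=> r; have [/= m1 m2 m3 m4] := wrel_ends r.
  rewrite src_inv in m1; rewrite tgt_inv in m2; move/wrel_inv/IH: r => e.
  have c : src u = src (io x) by rewrite qmap_src.
  have c1 : tgt u = src (io y) by rewrite qmap_src.
  have c2 : tgt (io y) = src f by rewrite qmap_tgt.
  (* The relation for [f] is multiplied by [u] on the left and by [inv f] on the right. *)
  by rewrite -{1}(tmulKVg c) -e tmulA // tmulgK // tgt_tmul.
- by move=> /edge_sq_gen [v [s ->]]; apply: structure_gen_sq.
Qed.

(** The bijection is oriented from [u = x -> g] back to [g]; with this orientation labels multiply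
    as in [xy <- g = (x <- (y -> g)) (y <- g)]. *)
Definition vert_sq (x : A) (u w g : GA) : Prop :=
  exists y, edge_sq true g x u y /\ w = io y.

(** Starting from [g] the square is completed by [edge true]; starting from [u] it is completed by
    the reflected [edge false] and flipped. *)
Lemma vert_sqP x : labelled_bijection (@src _ GA) (@tgt _ GA) (src x) (tgt x)
  (vert_sq x).
Proof.
split.
- move=> u w g [y [r ->]]; have [/= m1 m2 m3 m4] := wrel_ends r.
  by rewrite qmap_src qmap_tgt.
- move=> u e; have [//|g [y h]] := @wrel_total _ _ _ _ _ _ (edge false) u x.
  by exists (io y), g, y; split=> //; apply: (@edge_sq_flip false).
- move=> g e; have [//|u [y h]] := @wrel_total _ _ _ _ _ _ (edge true) g x.
  by exists u, (io y), y.
- move=> u _ g _ g' [y [/edge_sq_flip h ->]] [y' [/edge_sq_flip h' ->]].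
  by have [-> ->] := lb_fun (wrelP _) h h'.
- move=> u _ g _ u' [y [h ->]] [y' [h' ->]].
  by have [-> ->] := lb_fun (wrelP _) h h'.
Qed.

Lemma vert_ghom : exists F : ghom GA (wreath (@src _ GA) (@tgt _ GA) GA),
  forall x, wrel (F (io x)) = vert_sq x.
Proof.
apply: structure_wreath vert_sqP _ => x y x' y' k j l u0 v0 s.
move=> [x1 [ex ->]] [y1 [ey ->]].
have [g1 [x1' [y1' [h1 h2 s1]]]] := edge_sq_sq s ey ex.
exists (io x1'), g1, (io y1'); split; [by exists x1' | by exists y1' |].
exact: structure_gen_sq.
Qed.

Definition vert : ghom GA (wreath (@src _ GA) (@tgt _ GA) GA) :=
  sval (cid vert_ghom).

Definition gsq (f g u v : GA) : Prop := wrel (vert f) u v g.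

Lemma gsq_gen x g u w : gsq (io x) g u w <-> vert_sq x u w g.
Proof. by rewrite /gsq /vert; case: cid => F /= ->. Qed.

Lemma gsq_ends f g u v : gsq f g u v ->
  [/\ tgt f = src g, src u = src f, tgt v = tgt g & tgt u = src v].
Proof. by move=> s; have [? ? ? ?] := wrel_ends s. Qed.

Lemma gsq_total f g : tgt f = src g -> exists u v, gsq f g u v.
Proof.
move=> c; have [u [v s]] := wrel_totalV vert (esym c).
by exists u, v.
Qed.

Lemma gsq_fun f g u v u' v' : gsq f g u v -> gsq f g u' v' -> u = u' /\ v = v'.
Proof. by move=> s s'; have [-> ->] := lb_funV (wrelP _) s s'. Qed.

Lemma gsq_tmull f h g g1 u v1 v2 : tgt f = src h ->
  gsq f g1 u v1 -> gsq h g g1 v2 -> gsq (f ** h) g u (v1 ** v2).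
Proof. by move=> c s1 s2; apply/wrel_tmul => //; exists v1, g1, v2. Qed.

(** Multiplicativity in the second argument is not built into [vert]; by induction on [f] it reduces
    to a generator, where it is multiplicativity of [edge]. *)
Lemma gsq_tmulr f g h u v w z : gsq f g u v -> gsq v h w z ->
  gsq f (g ** h) (u ** w) z.
Proof.
elim/structure_ind: f g h u v w z => [p|f1 f2 c IH1 IH2|f IH|x] g h u v w z e1 e2;
  have [fg uf vg uv] := gsq_ends e1; have [vh wv zh wz] := gsq_ends e2.
- move/wrel_one: e1 => [up ev eu]; rewrite ev in e2.
  move/wrel_one: e2 => [_ -> ->]; rewrite -eu; rewrite ev endE in vh.
  by apply/wrel_one; rewrite src_tmul ?tgt_tmul.
- case/wrel_tmul: e1 => // v1 [g1 [v2 [r1 r2 ev]]]; rewrite ev in e2.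
  have [_ _ _ v12] := gsq_ends r1; have [_ t2 _ t3] := gsq_ends r2.
  have cv : tgt v1 = src v2.
    by have [_ _ -> _] := gsq_ends r1; rewrite t3.
  (* The factorisation of [v] splits the second square too; the resulting two by two array is pasted
     factor by factor. *)
  case/wrel_tmul: e2 => // z1 [h1 [z2 [q1 q2 ->]]].
  apply/wrel_tmul => //; exists z1, (g1 ** h1), z2; split=> //; first exact: IH1 q1.
  exact: IH2 q2.
- move/wrel_inv: e1 => e1; apply/wrel_inv.
  by apply: IH e1 _; apply/wrel_inv; rewrite invK.
- move/gsq_gen: e1 => [y [h1 ev]]; rewrite ev in e2.
  move/gsq_gen: e2 => [y' [h2 ->]].
  apply/gsq_gen; exists y'; split=> //; apply/wrel_tmul; first by rewrite -vg.
  by exists u, y, w.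
Qed.

Lemma gsq_onel g : gsq (one GA (src g)) g g (one GA (tgt g)).
Proof. by apply/wrel_one. Qed.

Lemma gsq_oner f : gsq f (one GA (tgt f)) (one GA (src f)) f.
Proof.
elim/structure_ind: f => [p|f g c IHf IHg|f IH|x].
- by apply/wrel_one; rewrite !endE.
- rewrite src_tmul ?tgt_tmul //; apply/wrel_tmul => //.
  by exists f, (one GA (tgt f)), g; split=> //; rewrite c.
- by rewrite !endE; apply/wrel_inv; rewrite invK.
- apply/gsq_gen; exists x; split=> //; apply/wrel_one.
  by rewrite qmap_src qmap_tgt.
Qed.

Lemma gsq_tmul f g u v : gsq f g u v -> f ** g = u ** v.
Proof.
elim/structure_ind: f g u v => [p|f h c IHf IHh|f IH|x] g u v.
- by move/wrel_one => [e -> <-]; rewrite tmul1g ?tmulg1.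
- move/wrel_tmul => [//|v1 [g1 [v2 [r1 r2 ->]]]].
  have [? ? ? ?] := gsq_ends r1; have [? ? ? ?] := gsq_ends r2.
  have ? : tgt v1 = src v2 by congruence.
  by rewrite -tmulA // (IHh _ _ _ r2) tmulA // (IHf _ _ _ r1) tmulA.
- move/wrel_inv => r; have [c1 c2 c3 c4] := gsq_ends r.
  rewrite tgt_inv in c3; rewrite src_inv in c4.
  rewrite -{1}(tmulgKV c4) -(IH _ _ _ r) -tmulA // tmulKg //.
  by rewrite src_tmul.
- by move/gsq_gen => [y [/edge_sq_tmul e ->]].
Qed.

End Extension.

(** * Braided groupoids in terms of squares *)

Section BraidedSquares.
Context (P : Type) (G : groupoid P).

(** The actions are chosen from the total functional relation [S]. Pasting in the first argument
    yields the left action law and [ract_mul]; pasting in the second yields the right action law and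
    [lact_mul]. *)
Lemma braided_structure_of_squares (S : G -> G -> G -> G -> Prop) :
  (forall f g u v, S f g u v ->
    [/\ tgt f = src g, src u = src f, tgt v = tgt g & tgt u = src v]) ->
  (forall f g, tgt f = src g -> exists u v, S f g u v) ->
  (forall f g u v u' v', S f g u v -> S f g u' v' -> u = u' /\ v = v') ->
  (forall g, S (one G (src g)) g g (one G (tgt g))) ->
  (forall f, S f (one G (tgt f)) (one G (src f)) f) ->
  (forall f h g g1 u v1 v2, tgt f = src h ->
    S f g1 u v1 -> S h g g1 v2 -> S (f ** h) g u (v1 ** v2)) ->
  (forall f g h u v w z,
    S f g u v -> S v h w z -> S f (g ** h) (u ** w) z) ->
  (forall f g u v, S f g u v -> f ** g = u ** v) ->
  exists B : braided_structure G,
    forall f g u v, S f g u v -> sq (A := bs_braided_quiver B) f g u v.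
Proof.
move=> S_ends S_total S_fun S1l S1r SMl SMr SM.
have S_ex f g (c : tgt f = src g) : exists uv, S f g uv.1 uv.2.
  by have [u [v s]] := S_total f g c; exists (u, v).
pose la f g (c : tgt f = src g) := (sval (cid (S_ex f g c))).1.
pose ra f g (c : tgt f = src g) := (sval (cid (S_ex f g c))).2.
have SP f g c : S f g (la f g c) (ra f g c) by rewrite /la /ra; case: cid.
have SE f g u v c : S f g u v -> la f g c = u /\ ra f g c = v.
  exact: S_fun (SP f g c).
have laP : is_left_action la.
  split=> [f g c|f h g hg f_hg fh fh_g|f c].
  - by have [] := S_ends _ _ _ _ (SP f g c).
  - have s := SMl _ _ _ _ _ _ _ fh (SP _ _ f_hg) (SP _ _ hg).
    by rewrite -tmulE in s; have [-> _] := SE _ _ _ _ fh_g s.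
  - by have [-> _] := SE _ _ _ _ c (S1l f).
have raP : is_right_action ra.
  split=> [f g c|f g h fg fg_h gh f_gh|f c].
  - by have [] := S_ends _ _ _ _ (SP f g c).
  - have s := SMr _ _ _ _ _ _ _ (SP _ _ fg) (SP _ _ fg_h).
    by rewrite -tmulE in s; have [_ ->] := SE _ _ _ _ f_gh s.
  - by have [_ ->] := SE _ _ _ _ c (S1r f).
have t_la f g c : tgt (la f g c) = src (ra f g c).
  by have [] := S_ends _ _ _ _ (SP f g c).
have la_mul x f g (xf : tgt x = src f) (fg : tgt f = src g)
    (x_fg : tgt x = src (mul f g fg)) (xf_g : tgt (ra x f xf) = src g)
    (c : tgt (la x f xf) = src (la _ _ xf_g)) :
    la _ _ x_fg = mul (la x f xf) (la _ _ xf_g) c.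
  have s := SMr _ _ _ _ _ _ _ (SP _ _ xf) (SP _ _ xf_g).
  by rewrite -tmulE in s; have [-> _] := SE _ _ _ _ x_fg s; rewrite tmulE.
have ra_mul x y g (xy : tgt x = src y) (yg : tgt y = src g)
    (xy_g : tgt (mul x y xy) = src g) (x_yg : tgt x = src (la _ _ yg))
    (c : tgt (ra _ _ x_yg) = src (ra _ _ yg)) :
    ra _ _ xy_g = mul (ra _ _ x_yg) (ra _ _ yg) c.
  have s := SMl _ _ _ _ _ _ _ xy (SP _ _ x_yg) (SP _ _ yg).
  by rewrite -tmulE in s; have [_ ->] := SE _ _ _ _ xy_g s; rewrite tmulE.
have la_ra f g (fg : tgt f = src g) (c : tgt (la f g fg) = src (ra f g fg)) :
    mul f g fg = mul (la f g fg) (ra f g fg) c.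
  by rewrite !tmulE; apply/SM/SP.
exists (BraidedStructure laP raP t_la la_mul ra_mul la_ra) => f g u v s.
have [c _ _ _] := S_ends _ _ _ _ s; exists c; exact: SE.
Qed.

(** Squares are total in [B] and functional in [C], so an inclusion already identifies the
    actions. *)
Lemma braided_structure_eq (B C : braided_structure G) :
  (forall f g u v, sq (A := bs_braided_quiver B) f g u v ->
    sq (A := bs_braided_quiver C) f g u v) -> B = C.
Proof.
move=> BC.
have E f g c : lact B f g c = lact C f g c /\ ract B f g c = ract C f g c.
  have [|d [<- <-]] := BC f g (lact B f g c) (ract B f g c); first by exists c.
  by rewrite (Prop_irrelevance d c).
have el : @lact _ _ B = @lact _ _ C.
  do 2!apply: functional_extensionality_dep => ?.
  by apply: functional_extensionality_dep => c; have [] := E _ _ c.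
have er : @ract _ _ B = @ract _ _ C.
  do 2!apply: functional_extensionality_dep => ?.
  by apply: functional_extensionality_dep => c; have [] := E _ _ c.
case: B C el er {BC E} => [l r p1 p2 p3 p4 p5 p6] [l' r' q1 q2 q3 q4 q5 q6] /= el er.
move: p1 p2 p3 p4 p5 p6 q1 q2 q3 q4 q5 q6; rewrite el er => *.
by congr BraidedStructure; apply: Prop_irrelevance.
Qed.

Context (C : braided_structure G).
Local Notation csq := (@sq P (bs_braided_quiver C)).
Implicit Types f g h u v w : G.

Lemma bs_sq_tmul f g u v : csq f g u v -> f ** g = u ** v.
Proof.
by case=> c [<- <-]; rewrite -(tmulE c) (lact_ract (tgt_lact C c)) tmulE.
Qed.

Lemma bs_sq_tmull f h g g1 u v1 v2 : tgt f = src h ->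
  csq f g1 u v1 -> csq h g g1 v2 -> csq (f ** h) g u (v1 ** v2).
Proof.
move=> c [fg [eu ev]] [hg [eg1 ev2]]; move: fg eu ev; rewrite -{}eg1 => fg <- <-.
rewrite -(tmulE c) -ev2; have d : tgt (mul f h c) = src g by rewrite endE.
exists d; split; first exact/esym/lact_lact.
have e : tgt (ract C _ _ fg) = src (ract C _ _ hg) by rewrite tgt_ract tgt_lact.
by rewrite -(tmulE e); apply: ract_mul.
Qed.

Lemma bs_sq_tmulr f g h u v w z : csq f g u v -> csq v h w z ->
  csq f (g ** h) (u ** w) z.
Proof.
move=> [fg [<- ev]] [vh [<- <-]]; move: vh; rewrite -{}ev => vh.
have c : tgt g = src h by rewrite -vh; exact/esym/tgt_ract.
have d : tgt f = src (mul g h c) by rewrite endE.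
rewrite -(tmulE c); exists d; split; last exact/esym/ract_ract.
have e : tgt (lact C _ _ fg) = src (lact C _ _ vh) by rewrite src_lact tgt_lact.
by rewrite -(tmulE e); apply: lact_mul.
Qed.

(** The action axiom gives only the upper edge [g]; the remaining edge is an identity by
    cancellation in [f ** g = u ** v]. *)
Lemma bs_sq_onel g : csq (one G (src g)) g g (one G (tgt g)).
Proof.
have [|u [v s]] := @sq_total P (bs_braided_quiver C) (one G (src g)) g.
  exact: tgt_one.
have eu : u = g by case: s => c [<- _]; apply: lact1.
rewrite eu in s; have [c1 _ c2 c3] := sq_ends s.
suff <- : v = one G (tgt g) by [].
apply: (@tmul_injl _ _ g) => //; first by rewrite src_one.
by rewrite -(bs_sq_tmul s) tmul1g // tmulg1.
Qed.

Lemma bs_sq_oner f : csq f (one G (tgt f)) (one G (src f)) f.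
Proof.
have [|u [v s]] := @sq_total P (bs_braided_quiver C) f (one G (tgt f)).
  exact/esym/src_one.
have ev : v = f by case: s => c [_ <-]; apply: ract1.
rewrite ev in s; have [c1 c2 _ c3] := sq_ends s.
suff <- : u = one G (src f) by [].
apply: (@tmul_injr _ _ _ _ f) => //; first by rewrite tgt_one.
by rewrite -(bs_sq_tmul s) tmul1g // tmulg1.
Qed.

Lemma tmul_one_inv f g : tgt f = src g -> f ** g = one G (src f) -> f = inv g.
Proof. by move=> c e; apply: (inv_uniq (c := c)); rewrite tmulE. Qed.

(** A square on [inv f] and [u] is pasted to the given one; the result lies over an identity, so
    comparison with the identity square determines its edges. *)
Lemma bs_sq_invl f g u v : csq f g u v -> csq (inv f) u g (inv v).
Proof.
move=> s; have [fg uf vg uv] := sq_ends s.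
have [|g' [v' s']] := @sq_total P (bs_braided_quiver C) (inv f) u.
  by rewrite tgt_inv uf.
have [_ _ v'u _] := sq_ends s'.
have := bs_sq_tmull (tgt_inv f) s' s; rewrite tmulVg fg => h.
have [eg e] := sq_fun (bs_sq_onel g) h; rewrite -eg in s'.
have [_ _ _ gv'] := sq_ends s'; have v'v : tgt v' = src v by rewrite v'u uv.
suff <- : v' = inv v by [].
by apply: tmul_one_inv => //; rewrite -e -[src v']gv'.
Qed.

Lemma bs_sq_invr f g u v : csq f g u v -> csq v (inv g) (inv u) f.
Proof.
move=> s; have [fg uf vg uv] := sq_ends s.
have [|u' [f' s']] := @sq_total P (bs_braided_quiver C) v (inv g).
  by rewrite src_inv vg.
have [_ u'v _ _] := sq_ends s'.
have := bs_sq_tmulr s s'; rewrite tmulgV -fg => h.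
have [e ef] := sq_fun (bs_sq_oner f) h; rewrite -ef in s'.
have uu' : tgt u = src u' by rewrite [src u']u'v uv.
suff -> : inv u = u' by [].
by rewrite (tmul_one_inv uu') ?invK // -e [src u]uf.
Qed.

End BraidedSquares.

(** * Preservation of squares by morphisms *)

Section Universality.
Context (P : Type) (A : braided_quiver P) (A_nondeg : nondegenerate A).
Local Notation GA := (structure_groupoid A).
Local Notation io := (structure_gen A).
Context (G : groupoid P) (C : braided_structure G) (phi : qhom A G)
  (phi_braided : is_braided_morphism (B := bs_braided_quiver C) phi)
  (F : ghom GA G) (F_io : forall x, F (io x) = phi x).
Local Notation csq := (@sq P (bs_braided_quiver C)).

Lemma edge_sq_morph g x u y : edge_sq A_nondeg true g x u y ->
  csq (F (io x)) (F g) (F u) (F (io y)).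
Proof.
elim/structure_ind: g x u y => [p|f g c IHf IHg|f IH|a] x u y.
- move=> /wrel_one [<- -> <-]; rewrite !gmap_one.
  have := bs_sq_oner C (F (io x)); by rewrite !qmap_tgt !qmap_src.
- move=> /wrel_tmul [//|u1 [j [u2 [e1 e2 ->]]]].
  have [_ _ _ t] := wrel_ends e1; have [_ _ t' _] := wrel_ends e2.
  rewrite !gmap_tmul ?t ?t' //.
  exact: bs_sq_tmulr (IHf _ _ _ e1) (IHg _ _ _ e2).
- move=> /wrel_inv /IH /bs_sq_invr.
  by rewrite !gmap_inv invK.
- move=> /edge_sq_gen [v [s ->]]; rewrite !F_io.
  by move/(braided_morphismP (B := bs_braided_quiver C)): phi_braided; apply.
Qed.

(** Pasting and inversion of squares in [C] handle products and inverses. With [F] the identity this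
    yields uniqueness of the braided structure, and with [F] induced by [phi] it yields
    universality. *)
Lemma gsq_morph f g u v : gsq A_nondeg f g u v -> csq (F f) (F g) (F u) (F v).
Proof.
elim/structure_ind: f g u v => [p|f h c IHf IHh|f IH|x] g u v.
- move=> /wrel_one [<- -> ->]; rewrite !gmap_one.
  by have := bs_sq_onel C (F g); rewrite qmap_src qmap_tgt.
- move=> /wrel_tmul [//|v1 [g1 [v2 [e1 e2 ->]]]].
  have [_ _ t1 _] := gsq_ends e1; have [_ _ _ t2] := gsq_ends e2.
  rewrite !gmap_tmul ?t1 ?t2 //.
  exact: bs_sq_tmull (qhom_composable F F c) (IHf _ _ _ e1) (IHh _ _ _ e2).
- move=> /wrel_inv /IH /bs_sq_invl.
  by rewrite !gmap_inv invK.
- by move=> /gsq_gen [y [/edge_sq_morph s ->]].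
Qed.

End Universality.

(** * Existence, uniqueness and universality *)

Definition gid (P : Type) (G : groupoid P) : ghom G G.
Proof.
refine (@GHom P G G (qid G) (fun=> erefl) _) => f g c d.
exact: mul_congr.
Defined.

Theorem theorem3p8 (P : Type) (P_nonempty : inhabited P) (A : braided_quiver P)
    (A_nondeg : nondegenerate A) :
  (exists! B : braided_structure (structure_groupoid A),
     is_braided_morphism (A := A) (B := bs_braided_quiver B) (structure_gen A))
  /\
  (forall B : braided_structure (structure_groupoid A),
     is_braided_morphism (A := A) (B := bs_braided_quiver B) (structure_gen A) ->
   forall (G : groupoid P) (C : braided_structure G) (phi : qhom A G),
     is_braided_morphism (A := A) (B := bs_braided_quiver C) phi ->
     exists! phihat : bghom B C,
       forall x : A, phi x = phihat (structure_gen A x)).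
Proof.
(* Every admissible structure contains the constructed squares, by preservation under the identity
   morphism. *)
have gsqB (B : braided_structure (structure_groupoid A)) :
    is_braided_morphism (A := A) (B := bs_braided_quiver B) (structure_gen A) ->
    forall f g u v, gsq A_nondeg f g u v -> sq (A := bs_braided_quiver B) f g u v.
  move=> hB f g u v s.
  exact: (@gsq_morph P A A_nondeg _ B (structure_gen A) hB (gid _) (fun=> erefl)).
split.
  have [B BS] := braided_structure_of_squares (gsq_ends (A_nondeg := A_nondeg))
    (gsq_total A_nondeg) (@gsq_fun _ _ A_nondeg) (gsq_onel A_nondeg)
    (gsq_oner A_nondeg) (@gsq_tmull _ _ A_nondeg) (@gsq_tmulr _ _ A_nondeg)
    (@gsq_tmul _ _ A_nondeg).
  exists B; split=> [|C hC].
    apply/(braided_morphismP (B := bs_braided_quiver B)) => x y u v s.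
    apply/BS/gsq_gen; exists v; split=> //; apply/edge_sq_gen.
    by exists u.
  (* Conversely each square of [B] is a constructed one, by totality of the latter and functionality
     in [B]; hence it is a square of [C]. *)
  apply: braided_structure_eq => f g u v s; have [c _ _ _] := sq_ends s.
  have [u' [v' s']] := gsq_total A_nondeg c.
  by have [-> ->] := sq_fun s (BS _ _ _ _ s'); apply: gsqB.
move=> B hB G C phi hphi.
have [|F FE] := structure_ghom (phi := phi).
  move=> x y u v s; apply: (bs_sq_tmul (C := C)).
  by move/(braided_morphismP (B := bs_braided_quiver C)): hphi; apply.
have FS f g u v : sq (A := bs_braided_quiver B) f g u v ->
    sq (A := bs_braided_quiver C) (F f) (F g) (F u) (F v).
  move=> s; have [c _ _ _] := sq_ends s.
  have [u' [v' s']] := gsq_total A_nondeg c.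
  have [-> ->] := sq_fun s (gsqB _ hB _ _ _ _ s').
  exact: (gsq_morph hphi FE s').
have Fl f g (c : tgt f = src g) (d : tgt (F f) = src (F g)) :
    F (lact B f g c) = lact C (F f) (F g) d.
  have [|e [<- _]] := FS f g (lact B f g c) (ract B f g c); first by exists c.
  exact: lact_congr.
have Fr f g (c : tgt f = src g) (d : tgt (F f) = src (F g)) :
    F (ract B f g c) = ract C (F f) (F g) d.
  have [|e [_ <-]] := FS f g (lact B f g c) (ract B f g c); first by exists c.
  exact: ract_congr.
exists (BGHom Fl Fr); split=> [x|F' F'E]; first by rewrite /= FE.
(* Uniqueness holds already for groupoid morphisms, which are determined by their values on
   generators. *)
apply: bghom_eq => f; elim/structure_ind: f => [p|f g c /= IHf IHg|f /= IH|x] /=.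
- by rewrite !gmap_one.
- by rewrite !gmap_tmul // IHf IHg.
- by rewrite !gmap_inv IH.
- by rewrite FE F'E.
Qed.
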